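(* Fix $N_0>0$, $\nu>0$ and $\Lambda>2^{3/2}$, and let $N_n=N_0\Lambda^n$ for $n\ge0$. Consider, for $\alpha>0$, the system $$\dot u_n+\nu N_n^{2\alpha}u_n=N_{n-1}u_{n-1}^2-N_nu_nu_{n+1}\quad(n\ge0),\qquad u_n(0)=h_n$$ (incoming term equal to $0$ for $n=0$). Within the parameter range $\alpha>0$, the exponent $\alpha=1/3$ is the sharp threshold for global regularity of all non-negative smooth initial data, in the following sense: (i) for every $\alpha\ge1/3$, every non-negative $h\in H_N^\infty$ produces a globally smooth solution, which is unique among global non-negative Leray--Hopf solutions with datum $h$; (ii) for every $0<\alpha<1/3$, there are non-negative $h\in H_N^\infty$ whose corresponding maximal smooth solution has finite existence time, $T_{\max}<\infty$.
   Context: For $s\in\mathbb R$, $H_N^s$ is the space of real sequences $u=(u_n)_{n\ge0}$ with $\|u\|_{H_N^s}^2=\sum_{n\ge0}N_n^{2s}|u_n|^2<\infty$, and $H_N^\infty=\bigcap_{s>0}H_N^s$; a datum is smooth if it lies in $H_N^\infty$. ''Non-negative'' means all coordinates are $\ge0$ (at all times, for a solution). A finite-energy solution on an interval $I\subset[0,\infty)$ is an $\ell^2$-valued map $u$ on $I$ whose coordinates $u_n$ belong to $C^1(I)$ and satisfy the equations for every $n\ge0$ (one-sided derivatives at included endpoints), with $u_n(0)=h_n$ for all $n$ if $0\in I$. A finite-energy solution on $[0,T)$ ($0<T\le\infty$; global means $T=\infty$) is a Leray--Hopf solution if $$\|u(t)\|_{\ell^2}^2+2\nu\int_{t_0}^t\|u(\tau)\|_{H_N^\alpha}^2\,\mathrm{d}\tau\le\|u(t_0)\|_{\ell^2}^2$$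 holds for $t_0=0$ and for almost every $t_0\in(0,T)$, and for every $t\in[t_0,T)$. A finite-energy solution is smooth on $I$ if $\sup_{t\in J}\|u(t)\|_{H_N^s}<\infty$ for every compact interval $J\subset I$ and every $s>0$; globally smooth means smooth on $[0,\infty)$. For non-negative $h\in H_N^\infty$ there is a local non-negative smooth solution, and non-negative smooth solutions on a common interval with the same datum coincide; the maximal smooth existence time $T_{\max}\in(0,\infty]$ is the supremum of the $T>0$ for which a non-negative smooth solution with datum $h$ exists on $[0,T)$. *)

(* Defs.v *)
From HB Require Import structures.
From mathcomp Require Import all_boot all_order all_algebra.
From mathcomp Require Import all_classical all_reals all_analysis.

Set Implicit Arguments.
Unset Strict Implicit.
Unset Printing Implicit Defensive.

Import Order.TTheory GRing.Theory Num.Theory.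
Import numFieldNormedType.Exports.

Local Open Scope classical_set_scope.
Local Open Scope ring_scope.

Section DyadicModel.
Variables (R : realType) (N0 Lam : R).

Definition freq (n : nat) : R := N0 * Lam ^+ n.

Definition l2normsq (u : nat -> R) : \bar R :=
  (\sum_(0 <= n <oo) (`|u n| ^+ 2)%:E)%E.

Definition Hnormsq (s : R) (u : nat -> R) : \bar R :=
  (\sum_(0 <= n <oo) (freq n `^ (2 * s) * `|u n| ^+ 2)%:E)%E.

Definition in_l2 (u : nat -> R) : Prop := (l2normsq u < +oo)%E.

Definition in_H (s : R) (u : nat -> R) : Prop := (Hnormsq s u < +oo)%E.

Definition in_Hinf (u : nat -> R) : Prop := forall s : R, 0 < s -> in_H s u.

Definition nonneg_seq (u : nat -> R) : Prop := forall n, 0 <= u n.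

(* The limit is taken along I \ {t}: at an endpoint of an interval I that
   belongs to I this is the one-sided derivative. *)
Definition is_derive_within (I : set R) (f : R -> R) (t l : R) : Prop :=
  (f s - f t) / (s - t) @[s --> within I t^'] --> l.

Definition C1_on (I : set R) (f : R -> R) : Prop :=
  exists2 g : R -> R,
    forall t, I t -> is_derive_within I f t (g t) & {within I, continuous g}.

Definition incoming (u : nat -> R) (n : nat) : R :=
  if n is m.+1 then freq m * u m ^+ 2 else 0.

(* A solution is a total function of time; only its values on I matter. *)
Definition finite_energy_solution (nu alpha : R) (h : nat -> R) (I : set R)
    (u : R -> nat -> R) : Prop :=
  [/\ forall t, I t -> in_l2 (u t),
      forall n, C1_on I (fun t => u t n),
      forall n t, I t -> is_derive_within I (fun t => u t n) t
        (incoming (u t) n - freq n * u t n * u t n.+1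
         - nu * freq n `^ (2 * alpha) * u t n)
    & I 0 -> forall n, u 0 n = h n].

Definition nonneg_on (I : set R) (u : R -> nat -> R) : Prop :=
  forall t, I t -> nonneg_seq (u t).

Definition smooth_on (I : set R) (u : R -> nat -> R) : Prop :=
  forall a b : R, `[a, b] `<=` I -> forall s : R, 0 < s ->
    (ereal_sup [set Hnormsq s (u t) | t in `[a, b]] < +oo)%E.

(* [0, T) for an extended real T; T = +oo gives [0, oo). *)
Definition times (T : \bar R) : set R := [set t | 0 <= t /\ (t%:E < T)%E].

Definition energy_ineq (nu alpha : R) (u : R -> nat -> R) (t0 t : R) : Prop :=
  (l2normsq (u t) +
   (2 * nu)%:E * \int[lebesgue_measure]_(tau in `[t0, t]) Hnormsq alpha (u tau)
   <= l2normsq (u t0))%E.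

Definition Leray_Hopf (nu alpha : R) (h : nat -> R) (T : \bar R)
    (u : R -> nat -> R) : Prop :=
  [/\ (0 < T)%E,
      finite_energy_solution nu alpha h (times T) u,
      forall t : R, 0 <= t -> (t%:E < T)%E -> energy_ineq nu alpha u 0 t
    & {ae lebesgue_measure, forall t0 : R, 0 < t0 -> (t0%:E < T)%E ->
        forall t : R, t0 <= t -> (t%:E < T)%E -> energy_ineq nu alpha u t0 t}].

Definition nonneg_smooth_solution (nu alpha : R) (h : nat -> R) (T : \bar R)
    (u : R -> nat -> R) : Prop :=
  [/\ (0 < T)%E,
      finite_energy_solution nu alpha h (times T) u,
      smooth_on (times T) u
    & nonneg_on (times T) u].

Definition Tmax (nu alpha : R) (h : nat -> R) : \bar R :=
  ereal_sup [set T | exists u, nonneg_smooth_solution nu alpha h T u].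

Definition maximal_smooth_solution (nu alpha : R) (h : nat -> R)
    (u : R -> nat -> R) : Prop :=
  nonneg_smooth_solution nu alpha h (Tmax nu alpha h) u.

End DyadicModel.

(* Main.v *)
Require Import Defs.
From HB Require Import structures.
From mathcomp Require Import all_boot all_order all_algebra.
From mathcomp Require Import all_classical all_reals all_analysis.
From mathcomp Require Import measurable_realfun ring lra.

(* For two non-negative solutions u, v the quantity sum_n 2^-n (v_n - u_n)^2 is
   non-increasing up to a boundary term at high shells, because the weights 2^-n
   cancel the quadratic cross terms. This gives uniqueness; applied to a Galerkin
   solution and its time shifts, it bounds sum_n 2^-n |u_n'|^2 by its initial
   value.

   Let the damping coefficients d_n grow like q^n, q = Lam^(2 alpha). For q > 2 the
   bound on u' makes the time derivative negligible in the balance of the energy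
   fluxes P_n = N_n u_n^2 u_(n+1), which thus nearly decrease with n, by at least
   half of the dissipation d_n u_n^2. If also Lam^2 <= q^3, that is
   alpha >= 1/3, then P_n is at most a constant times the dissipation, so that the
   dissipation decays like 1/n and N_n u_n = o(d_(n+1)) uniformly in time. From
   some shell on the equations are then dominated by linear ones and u_n decays
   faster than any power of Lam^-n, uniformly in time and in the truncation.

   For alpha < 1/3 let theta = Lam^(1/3 - 2 alpha). Along a smooth solution the
   weighted sum g = sum_n theta^n u_n satisfies g' >= c g^2 - C, hence a datum
   concentrated on the first shell with large amplitude leaves the smooth class
   before a fixed time. *)

Set Implicit Arguments.
Unset Strict Implicit.
Unset Printing Implicit Defensive.

Import Order.TTheory GRing.Theory Num.Theory.
Import numFieldNormedType.Exports.

Local Open Scope classical_set_scope.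
Local Open Scope ring_scope.

(** * One-sided derivatives *)

(** The bound on sum_n 2^-n |u_n'|^2 still lets |u_n'|^2 grow like 2^n. Its cost in the flux balance
    is |u_n'|^2 / d_n, of order (2/q)^n, and q > 2 makes the total cost summable; for alpha >= 1/3
    this is what Lam > 2^(3/2) provides, since q >= Lam^(2/3).

    The boundary term in the weighted difference of two solutions is controlled only if one of them
    decays. Before any decay is known, a solution is therefore compared with its time shifts on
    truncated systems, where this term vanishes identically, and bounds uniform in the truncation
    pass to a coordinatewise limit. For uniqueness, decay of one of the two solutions suffices, the
    other being bounded by its energy.

    Global non-negative solutions exist for every alpha, as limits of truncated ones. Below 1/3 the
    maximal smooth solution is the restriction of such a global solution, identified by uniqueness,
    so no continuation criterion is used. *)

Section WithinDerivative.
Variable R : realType.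
Implicit Types (I J : set R) (f g : R -> R).

(** Clearing the denominator of the difference quotient also admits s = t, so that the punctured
    neighbourhood disappears. *)
Lemma dwP I f t l : is_derive_within I f t l <->
  forall e, 0 < e -> exists2 d, 0 < d & forall s, I s -> `|s - t| < d ->
    `|f s - f t - l * (s - t)| <= e * `|s - t|.
Proof.
split=> [/cvgrPdist_le H e e0|H].
  have := H e e0; rewrite /within/= /dnbhs => -[d /= d0 Hd]; exists d => // s Is std.
  have [->|st] := eqVneq s t; first by rewrite !subrr mulr0 subrr normr0 mulr0.
  have := Hd s; rewrite /ball/= distrC => /(_ std st Is).
  have s0 : s - t != 0 by rewrite subr_eq0.
  rewrite -(@ler_pM2r _ `|s - t|) ?normr_gt0// -normrM mulrBl divfK//.
  by rewrite distrC.
apply/cvgrPdist_le => e e0; have [d d0 Hd] := H e e0.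
rewrite /within/= /dnbhs; exists d => //= s; rewrite /ball/= distrC => std st Is.
have s0 : s - t != 0 by rewrite subr_eq0.
rewrite -(@ler_pM2r _ `|s - t|) ?normr_gt0// -normrM mulrBl divfK//.
by rewrite distrC; exact: Hd.
Qed.

Lemma near_cvg_to (F : set_system R) (FF : Filter F) f g (l : R) :
  (\forall x \near F, f x = g x) -> f @ F --> l -> g @ F --> l.
Proof.
move=> fg fl; suff gf : g @ F `=>` f @ F by exact: cvg_trans gf fl.
by apply: near_eq_cvg.
Qed.

Lemma dw_cvg I f t l : is_derive_within I f t l ->
  f s @[s --> within I t^'] --> f t.
Proof.
move=> H.
have idc : s - t @[s --> within I t^'] --> t - t.
  apply: cvg_within_filter.
  have Ht : (s : R) @[s --> t^'] --> t by exact: cvg_within.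
  exact: (cvgB Ht (cvg_cst t)).
have H1 : (f s - f t) / (s - t) * (s - t) + f t @[s --> within I t^'] -->
    l * (t - t) + f t by apply: cvgD (cvgM H idc) (cvg_cst (f t)).
move: H1; rewrite subrr mulr0 add0r => H1; apply: near_cvg_to H1.
rewrite near_withinE; rewrite /dnbhs near_withinE; apply: nearW => s st _ /=.
by rewrite divfK ?subrK// subr_eq0.
Qed.

Lemma dw_ext I f g t l : (forall s, I s -> f s = g s) -> f t = g t ->
  is_derive_within I f t l -> is_derive_within I g t l.
Proof.
move=> fg fgt /dwP H; apply/dwP => e /H[d d0 Hd]; exists d => // s Is std.
by rewrite -fg// -fgt; exact: Hd.
Qed.

Lemma dw_sub I J f t l : J `<=` I -> is_derive_within I f t l ->
  is_derive_within J f t l.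
Proof.
move=> JI /dwP H; apply/dwP => e /H[d d0 Hd]; exists d => // s Js.
exact/Hd/JI.
Qed.

Lemma dw_cst I c t : is_derive_within I (fun=> c) t 0.
Proof.
by apply/dwP => e e0; exists 1 => // s _ _; rewrite subrr mul0r subrr normr0 mulr_ge0// ltW.
Qed.

Lemma dw_add I f g t l m : is_derive_within I f t l -> is_derive_within I g t m ->
  is_derive_within I (fun s => f s + g s) t (l + m).
Proof.
move=> Hf Hg; rewrite /is_derive_within;
have H1 : (f s - f t) / (s - t) + (g s - g t) / (s - t) @[s --> within I t^'] -->
    l + m by apply: cvgD Hf Hg.
by apply: near_cvg_to H1; apply: nearW => s /=; rewrite -mulrDl; congr (_ / _); ring.
Qed.

Lemma dw_mul I f g t l m : is_derive_within I f t l -> is_derive_within I g t m ->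
  is_derive_within I (fun s => f s * g s) t (l * g t + f t * m).
Proof.
move=> Hf Hg; rewrite /is_derive_within.
have H1 : (f s - f t) / (s - t) * g s + f t * ((g s - g t) / (s - t))
    @[s --> within I t^'] --> l * g t + f t * m.
  by apply: cvgD (cvgM Hf (dw_cvg Hg)) (cvgM (cvg_cst (f t)) Hg).
by apply: near_cvg_to H1; apply: nearW => s /=; ring.
Qed.

Lemma dw_scale I c f t l : is_derive_within I f t l ->
  is_derive_within I (fun s => c * f s) t (c * l).
Proof. by move=> H; have := dw_mul (dw_cst I c t) H; rewrite mul0r add0r. Qed.

Lemma dw_opp I f t l : is_derive_within I f t l ->
  is_derive_within I (fun s => - f s) t (- l).
Proof.
move=> /(dw_scale (c := -1)); rewrite mulN1r; apply: dw_ext => [s _|]; exact: mulN1r.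
Qed.

Lemma dw_sum I (F : nat -> R -> R) (L : nat -> R) t n :
  (forall i, (i < n)%N -> is_derive_within I (F i) t (L i)) ->
  is_derive_within I (fun s => \sum_(i < n) F i s) t (\sum_(i < n) L i).
Proof.
elim: n => [|n IHn] H.
  by rewrite big_ord0; apply: dw_ext (dw_cst I 0 t) => [s _|]; rewrite big_ord0.
rewrite big_ord_recr/=.
apply: dw_ext (dw_add (IHn _) (H n (ltnSn n))) => [s _||i ?]; rewrite ?big_ord_recr//.
by apply: H; rewrite ltnS ltnW.
Qed.

Lemma dw_inv I f t l : f t != 0 -> is_derive_within I f t l ->
  is_derive_within I (fun s => (f s)^-1) t (- l / f t ^+ 2).
Proof.
move=> ft0 H; rewrite /is_derive_within.
have Hc := dw_cvg H.
have H1 : - ((f s - f t) / (s - t)) * (f s)^-1 * (f t)^-1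
    @[s --> within I t^'] --> - l * (f t)^-1 * (f t)^-1.
  by apply: cvgM (cvgM (cvgN H) (cvgV ft0 Hc)) (cvg_cst (f t)^-1).
move: H1; rewrite -mulrA -invfM -expr2 => H1; apply: near_cvg_to H1.
have : \forall s \near within I t^', f s != 0 by apply: cvgr_neq0 Hc ft0.
rewrite !near_withinE; apply: filterS => s /= fs0 st Is; field.
by rewrite subr_eq0 st ft0 fs0.
Qed.

Lemma dw_is_derive I f (t l : R) : is_derive t 1 f l -> is_derive_within I f t l.
Proof.
move=> [+ <-]; rewrite /derivable /derive => H; apply/dwP => e e0.
move/cvgrPdist_le : H => /(_ e e0); rewrite /dnbhs near_withinE => -[d /= d0 Hd].
exists d => // s Is std; have [->|st] := eqVneq s t.
  by rewrite !subrr mulr0 subrr normr0 mulr0.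
have s0 : s - t != 0 by rewrite subr_eq0.
have := Hd (s - t); rewrite /ball/= sub0r normrN => /(_ std s0).
rewrite /GRing.scale/= mulr1 subrK.
set L := lim _ => Hh; have -> : f s - f t - L * (s - t) =
  - ((L - (s - t)^-1 * (f s - f t)) * (s - t)) by field.
by rewrite normrN normrM ler_wpM2r.
Qed.

Lemma is_derive_dw I f (t l : R) : (\forall s \near t, I s) ->
  is_derive_within I f t l -> is_derive t 1 f l.
Proof.
move=> [d1 /= d10 Hd1] /dwP H.
suff : h^-1 *: (f (h *: (1 : R) + t) - f t) @[h --> 0^'] --> l.
  by move=> cf; apply: DeriveDef; [apply/cvg_ex; exists l | apply/cvg_lim].
apply/cvgrPdist_le => e e0; have [d d0 Hd] := H e e0.
rewrite /dnbhs near_withinE; exists (Num.min d d1); first by rewrite /= lt_min d0.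
move=> h /=; rewrite sub0r normrN lt_min => /andP[hd hd1] h0.
have := Hd (h + t); rewrite addrK => /(_ _ hd).
have It : I (h + t) by apply: Hd1; rewrite /ball/= opprD addrCA subrr addr0 normrN.
move/(_ It); rewrite /GRing.scale/= mulr1 => Hh.
have -> : l - h^-1 * (f (h + t) - f t) = - ((f (h + t) - f t - l * h) / h) by field.
by rewrite normrN normrM normfV ler_pdivrMr// normr_gt0.
Qed.

Lemma dw_continuous I f : (forall t, I t -> exists l, is_derive_within I f t l) ->
  {within I, continuous f}.
Proof.
move=> H; apply/subspace_continuousP => t It; have [l /dwP/(_ 1 ltr01)[d d0 Hd]] := H t It.
apply/cvgrPdist_le => e e0; rewrite near_withinE.
have C0 : 0 < 1 + `|l| by rewrite ltr_pwDl.
exists (Num.min d (e / (1 + `|l|))); first by rewrite /= lt_min d0 divr_gt0.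
move=> s /=; rewrite lt_min distrC => /andP[sd se] Is.
rewrite distrC -[f s - f t](subrK (l * (s - t))); apply: (le_trans (ler_normD _ _)).
apply: (@le_trans _ _ ((1 + `|l|) * `|s - t|)).
  by rewrite mulrDl lerD// ?Hd// normrM.
by rewrite mulrC -ler_pdivlMr// ltW.
Qed.

(** Points of the open segment are interior to [I], where the derivative within [I] is two-sided and
    the classical mean value theorem applies. *)
Lemma dw_le I f g C a b : a <= b -> `[a, b] `<=` I ->
  (forall t, a <= t <= b -> is_derive_within I f t (g t)) ->
  (forall t, a <= t <= b -> g t <= C) ->
  f b <= f a + C * (b - a).
Proof.
move=> ab abI df gC.
have D c : c \in `]a, b[%R -> is_derive c 1 f (g c).
  move=> cab; apply: (@is_derive_dw I); last by apply: df; rewrite !ltW ?(itvP cab).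
  near=> s; apply/abI/subset_itv_oo_cc; near: s; exact: near_in_itvoo.
have K : {within `[a, b], continuous f}.
  apply: dw_continuous => t; rewrite /= in_itv/= => tab; exists (g t).
  exact: dw_sub (df _ tab).
have [c cab fE] := MVT_segment ab D K.
rewrite -lerBlDl fE ler_wpM2r ?subr_ge0//.
by apply: gC; rewrite !(itvP cab).
Unshelve. all: by end_near.
Qed.
End WithinDerivative.

(** * Shell systems and their energies *)

Section Shells.
Variable R : realType.
Implicit Types (k d h u v : nat -> R) (T : \bar R).

Definition inflow k u n : R := if n is m.+1 then k m * u m ^+ 2 else 0.

(* Galerkin truncations are the systems in which k vanishes from some index on. *)
Definition rhs k d u n : R := inflow k u n - k n * u n * u n.+1 - d n * u n.

Definition shell_solution k d h T (u : R -> nat -> R) : Prop :=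
  [/\ forall t, times T t -> nonneg_seq (u t),
      forall n t, times T t ->
        is_derive_within (times T) (fun s => u s n) t (rhs k d (u t) n)
    & forall n, u 0 n = h n].

Lemma times_segment T (s t : R) : 0 <= s -> times T t -> `[s, t] `<=` times T.
Proof.
move=> s0 [t0 tT] r /=; rewrite in_itv/= => /andP[sr rt]; split.
  exact: le_trans sr.
by apply: le_lt_trans tT; rewrite lee_fin.
Qed.

Lemma dw_times_le T (f g : R -> R) C s t : 0 <= s -> s <= t -> times T t ->
  (forall r, times T r -> is_derive_within (times T) f r (g r)) ->
  (forall r, s <= r <= t -> g r <= C) ->
  f t <= f s + C * (t - s).
Proof.
move=> s0 st Tt df gC; have sub := times_segment s0 Tt.
by apply: (dw_le st sub) gC => r rst; apply/df/sub; rewrite /= in_itv.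
Qed.

(** Telescoping: the energy that leaves shell i enters shell i + 1, so only the outflow of the last
    shell remains. *)
Lemma sum_mul_rhs k d u N : \sum_(i < N.+1) u i * rhs k d u i =
  - (k N * u N ^+ 2 * u N.+1) - \sum_(i < N.+1) d i * u i ^+ 2.
Proof.
elim: N => [|N IHN]; first by rewrite !big_ord_recr !big_ord0 /rhs /inflow/=; ring.
by rewrite big_ord_recr/= IHN [in RHS]big_ord_recr/= /rhs /inflow; ring.
Qed.

Lemma dw_sqr_sum T (w : R -> nat -> R) (l : R -> nat -> R) (c : nat -> R) N t :
  (forall n, is_derive_within (times T) (fun s => w s n) t (l t n)) ->
  is_derive_within (times T) (fun s => \sum_(i < N) c i * w s i ^+ 2) t
    (2 * \sum_(i < N) c i * (w t i * l t i)).
Proof.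
move=> H; rewrite mulr_sumr.
under eq_bigr => i _.
  have -> : 2 * (c i * (w t i * l t i)) = c i * (l t i * w t i + w t i * l t i) by ring.
over.
apply: (@dw_sum _ _ (fun i s => c i * w s i ^+ 2)
  (fun i => c i * (l t i * w t i + w t i * l t i))) => i _.
apply: dw_scale; exact: dw_mul.
Qed.

Lemma energy_derive_le k d h T (u : R -> nat -> R) N t : (forall n, 0 <= k n) ->
  shell_solution k d h T u -> times T t ->
  2 * \sum_(i < N) 1 * (u t i * rhs k d (u t) i) <= - (2 * \sum_(i < N) d i * u t i ^+ 2).
Proof.
move=> k0 [u0 _ _] Tt; under eq_bigr do rewrite mul1r.
rewrite -mulrN ler_pM2l//; case: N => [|N]; first by rewrite !big_ord0 oppr0.
by rewrite sum_mul_rhs gerDr oppr_le0 !mulr_ge0 ?sqr_ge0//; exact: u0.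
Qed.

Lemma energy_le k d h T (u : R -> nat -> R) N s t : (forall n, 0 <= k n) -> (forall n, 0 <= d n) ->
  shell_solution k d h T u -> 0 <= s -> s <= t -> times T t ->
  \sum_(i < N) u t i ^+ 2 <= \sum_(i < N) u s i ^+ 2.
Proof.
move=> k0 d0 hu s0 st Tt; have [u0 du _] := hu.
have := @dw_times_le T (fun r => \sum_(i < N) 1 * u r i ^+ 2)
  (fun r => 2 * \sum_(i < N) 1 * (u r i * rhs k d (u r) i)) 0 s t s0 st Tt.
have E r : \sum_(i < N) 1 * u r i ^+ 2 = \sum_(i < N) u r i ^+ 2.
  by apply: eq_bigr => i _; rewrite mul1r.
rewrite mul0r addr0 !E; apply=> [r Tr|r rst].
  by apply: (@dw_sqr_sum T u (fun r => rhs k d (u r)) (fun=> 1)) => n; exact: du.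
apply: le_trans (energy_derive_le _ k0 hu _) _.
  by apply: (times_segment s0 Tt); rewrite /= in_itv.
by rewrite oppr_le0 mulr_ge0// sumr_ge0// => i _; rewrite mulr_ge0// sqr_ge0.
Qed.

(* Writing w = v - u and m = (u + v) / 2, the difference of two solutions obeys
   w_n' = 2 k_(n-1) m_(n-1) w_(n-1) - k_n m_(n+1) w_n - k_n m_n w_(n+1) - d_n w_n
   exactly; the weights 2^-n are those for which the cross terms cancel. *)
Lemma sum_half_pow_diff k d u v N :
  \sum_(i < N.+1) 2^-1 ^+ i * ((v i - u i) * (rhs k d v i - rhs k d u i)) =
  - (2^-1 ^+ N.+1 * (k N * ((v N ^+ 2 - u N ^+ 2) * (v N.+1 - u N.+1)))) -
  \sum_(i < N.+1) 2^-1 ^+ i * ((k i * ((u i.+1 + v i.+1) / 2) + d i) * (v i - u i) ^+ 2).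
Proof.
elim: N => [|N IHN].
  by rewrite !big_ord_recr !big_ord0 /rhs /inflow/= !expr1 expr0; field.
by rewrite big_ord_recr/= IHN [in RHS]big_ord_recr/= /rhs /inflow !exprS; field.
Qed.

(** In the expanded boundary product the terms in [u] alone and in [v] alone have a good sign. Each
    of the two mixed terms contains a factor of [u], so control of [u] at high shells will be
    enough. *)
Lemma half_pow_diff_le k d h1 h2 T (u v : R -> nat -> R) N s t B :
  (forall n, 0 <= k n) -> (forall n, 0 <= d n) ->
  shell_solution k d h1 T u -> shell_solution k d h2 T v ->
  0 <= s -> s <= t -> times T t ->
  (forall r, s <= r <= t ->
    k N * (v r N ^+ 2 * u r N.+1 + u r N ^+ 2 * v r N.+1) <= B) ->
  \sum_(i < N.+1) 2^-1 ^+ i * (v t i - u t i) ^+ 2 <=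
  \sum_(i < N.+1) 2^-1 ^+ i * (v s i - u s i) ^+ 2 + 2^-1 ^+ N * B * (t - s).
Proof.
move=> k0 d0 [u0 du _] [v0 dv _] s0 st Tt HB; have sub := times_segment s0 Tt.
apply: (@dw_times_le T (fun r => \sum_(i < N.+1) 2^-1 ^+ i * (v r i - u r i) ^+ 2)
  (fun r => 2 * \sum_(i < N.+1) 2^-1 ^+ i *
     ((v r i - u r i) * (rhs k d (v r) i - rhs k d (u r) i)))) => // [r Tr|r rst].
  apply: (@dw_sqr_sum _ (fun r n => v r n - u r n)
    (fun r n => rhs k d (v r) n - rhs k d (u r) n)) => n.
  by apply: dw_add; [exact: dv | apply: dw_opp; exact: du].
have Tr : times T r by apply: sub; rewrite /= in_itv.
rewrite sum_half_pow_diff.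
have h0 n : 0 <= (2^-1 : R) ^+ n by rewrite exprn_ge0// invr_ge0.
have S0 : 0 <= \sum_(i < N.+1) 2^-1 ^+ i *
    ((k i * ((u r i.+1 + v r i.+1) / 2) + d i) * (v r i - u r i) ^+ 2).
  apply: sumr_ge0 => i _; rewrite mulr_ge0// mulr_ge0 ?sqr_ge0// addr_ge0//.
  by rewrite mulr_ge0// divr_ge0// addr_ge0//; [exact: u0|exact: v0].
apply: le_trans (_ : 2^-1 ^+ N * (k N * (v r N ^+ 2 * u r N.+1 + u r N ^+ 2 * v r N.+1)) <= _).
  have P0 : 0 <= 2^-1 ^+ N * (k N * (v r N ^+ 2 * v r N.+1 + u r N ^+ 2 * u r N.+1)).
    by rewrite mulr_ge0// mulr_ge0// addr_ge0// mulr_ge0 ?sqr_ge0//; [exact: v0|exact: u0].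
  rewrite exprS; lra.
by rewrite ler_wpM2l// HB.
Qed.

Lemma ler_term_sum (F : nat -> R) n N : (n < N)%N -> (forall i, 0 <= F i) ->
  F n <= \sum_(i < N) F i.
Proof.
by move=> nN F0; rewrite (bigD1 (Ordinal nN))//= lerDl sumr_ge0.
Qed.

Lemma geometric_le0 (z C a : R) m : 0 <= z < 1 ->
  (forall N, (m <= N)%N -> a <= z ^+ N * C) -> a <= 0.
Proof.
move=> /andP[z0 z1] H.
have Hz : z ^+ n * C @[n --> \oo] --> 0 * C.
  by apply: cvgM (cvg_cst C); apply: cvg_expr; rewrite ger0_norm.
rewrite -(mul0r C); apply: ler_cvg_to (cvg_cst a) Hz _.
by exists m.
Qed.

Lemma shell_solution_unique k d h T (u v : R -> nat -> R) t C :
  (forall n, 0 <= k n) -> (forall n, 0 <= d n) ->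
  shell_solution k d h T u -> shell_solution k d h T v -> times T t ->
  (forall N r, 0 <= r <= t ->
    k N * (v r N ^+ 2 * u r N.+1 + u r N ^+ 2 * v r N.+1) <= C) ->
  forall n, v t n = u t n.
Proof.
move=> k0 d0 hu hv Tt HC n; have [t0 _] := Tt.
have h0 i : 0 <= (2^-1 : R) ^+ i by rewrite exprn_ge0// invr_ge0.
suff : 2^-1 ^+ n * (v t n - u t n) ^+ 2 <= 0.
  rewrite pmulr_rle0 ?exprn_gt0 ?invr_gt0//.
  by rewrite le_eqVlt ltNge sqr_ge0 orbF sqrf_eq0 subr_eq0 => /eqP.
apply: (@geometric_le0 2^-1 (C * t) _ n) => [|N nN].
  by rewrite invr_ge0 ler0n/= invf_lt1// ltr1n.
have := half_pow_diff_le k0 d0 hu hv (lexx 0) t0 Tt (HC N).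
rewrite [X in _ <= X + _]big1 => [|i _]; last first.
  by have [_ _ ->] := hu; have [_ _ ->] := hv; rewrite subrr expr0n mulr0.
rewrite add0r subr0 -mulrA; apply: le_trans.
apply: (@ler_term_sum (fun i => 2^-1 ^+ i * (v t i - u t i) ^+ 2)); first by rewrite ltnS.
by move=> i; rewrite mulr_ge0// sqr_ge0.
Qed.
End Shells.

(** * Truncated systems: bound on the time derivative *)

Section Truncated.
Variable R : realType.
Implicit Types (k d h : nat -> R).

Lemma times_pinfty (t : R) : times +oo t <-> 0 <= t.
Proof. by split=> [[]//|t0]; split=> //; rewrite ltry. Qed.

Lemma dw_shift (f : R -> R) t r l : 0 <= t -> 0 <= r ->
  is_derive_within (times +oo) f (t + r) l ->
  is_derive_within (times +oo) (fun s => f (s + r)) t l.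
Proof.
move=> t0 r0 /dwP H; apply/dwP => e /H[e1 e10 He]; exists e1 => // s /times_pinfty s0 st.
have := He (s + r); have -> : s + r - (t + r) = s - t by ring.
by apply => //; apply/times_pinfty; rewrite addr_ge0.
Qed.

Lemma shell_solution_shift k d h u r : 0 <= r ->
  shell_solution k d h +oo u ->
  shell_solution k d (u r) +oo (fun t => u (t + r)).
Proof.
move=> r0 [u0 du _]; split=> [t /times_pinfty t0|n t /times_pinfty t0|n].
- by apply: u0; apply/times_pinfty; rewrite addr_ge0.
- apply: (@dw_shift (fun s => u s n)) => //; apply: du.
  by apply/times_pinfty; rewrite addr_ge0.
- by rewrite add0r.
Qed.

Lemma dw_right (f : R -> R) t l : 0 <= t ->
  is_derive_within (times +oo) f t l ->
  (f (t + r) - f t) / r @[r --> 0^'+] --> l.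
Proof.
move=> t0 /dwP H; apply/cvgrPdist_le => e e0; have [e1 e10 He] := H e e0.
rewrite /at_right near_withinE; exists e1 => // r /=; rewrite sub0r normrN => re1 r0.
have := He (t + r); rewrite addrAC subrr add0r => /(_ _ re1).
have Itr : times +oo (t + r) by apply/times_pinfty; rewrite addr_ge0// ltW.
move=> /(_ Itr) Hr.
have rn0 : r != 0 by rewrite gt_eqF.
have -> : l - (f (t + r) - f t) / r = - ((f (t + r) - f t - l * r) / r) by field.
by rewrite normrN normrM normfV ler_pdivrMr// normr_gt0.
Qed.

(** Since [k K = 0], the weighted distance between [u] and its shift by r is non-increasing in time.
    Dividing by r^2 and letting r tend to 0 from the right turns the differences into right-hand
    sides. *)
Lemma sum_half_pow_rhs_le k d h u K t : (forall n, 0 <= k n) -> (forall n, 0 <= d n) ->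
  k K = 0 -> shell_solution k d h +oo u -> 0 <= t ->
  \sum_(i < K.+1) 2^-1 ^+ i * rhs k d (u t) i ^+ 2 <=
  \sum_(i < K.+1) 2^-1 ^+ i * rhs k d h i ^+ 2.
Proof.
move=> k0 d0 kK hu t0; have [u0 du uh] := hu.
have cvgq s : 0 <= s ->
    \sum_(i < K.+1) 2^-1 ^+ i * ((u (s + r) i - u s i) / r) ^+ 2 @[r --> 0^'+] -->
    \sum_(i < K.+1) 2^-1 ^+ i * rhs k d (u s) i ^+ 2.
  move=> s0; apply: (@cvg_big _ _ _ _ _ add_continuous) => // i _; apply: cvgM; first exact: cvg_cst.
  have Hi : (u (s + r) i - u s i) / r @[r --> 0^'+] --> rhs k d (u s) i.
    by apply: (@dw_right (fun s => u s i)) => //; apply/du/times_pinfty.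
  exact: (cvg_comp _ _ Hi (@exprn_continuous R 2 _)).
have -> : rhs k d h = rhs k d (u 0) by congr rhs; apply/funext => n; rewrite uh.
apply: ler_cvg_to (cvgq _ t0) (cvgq _ (lexx 0)) _.
near=> r; have r0 : 0 < r by near: r; exact: nbhs_right_gt.
have H : \sum_(i < K.+1) 2^-1 ^+ i * (u (t + r) i - u t i) ^+ 2 <=
    \sum_(i < K.+1) 2^-1 ^+ i * (u (0 + r) i - u 0 i) ^+ 2.
  have := @half_pow_diff_le _ k d _ _ +oo%E u (fun s => u (s + r)) K 0 t 0 k0 d0 hu
    (shell_solution_shift (ltW r0) hu) (lexx 0) t0 (proj2 (times_pinfty t) t0).
  by rewrite mulr0 mul0r addr0; apply => s _; rewrite kK mul0r.
have E s : \sum_(i < K.+1) 2^-1 ^+ i * ((u (s + r) i - u s i) / r) ^+ 2 =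
    (r ^-1) ^+ 2 * \sum_(i < K.+1) 2^-1 ^+ i * (u (s + r) i - u s i) ^+ 2.
  by rewrite mulr_sumr; apply: eq_bigr => i _; rewrite exprMn; ring.
by rewrite !E ler_wpM2l// sqr_ge0.
Unshelve. all: by end_near.
Qed.
End Truncated.

(** * Decay at high shells *)

Section Regularity.
Variable R : realType.
Implicit Types (k d h : nat -> R).

Lemma dw_expR D t (I : set R) :
  is_derive_within I (fun s => expR (D * s)) t (D * expR (D * t)).
Proof.
apply: dw_is_derive.
have H : is_derive t (1 : R) (fun s => D * s) D.
  by have := is_deriveZ D (is_derive_id t (1 : R)); rewrite /GRing.scale/= mulr1.
have := @is_derive1_comp _ expR (fun s => D * s) t _ _ (is_derive_expR _) H.
by rewrite mulrC.
Qed.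

(** Comparison with the relaxation f' = D (B - f): the factor exp(D s) makes exp(D s) (f - B)
    non-increasing. *)
Lemma dw_relax T (f g : R -> R) D B t : 0 <= D ->
  (forall s, times T s -> is_derive_within (times T) f s (g s)) ->
  (forall s, 0 <= s <= t -> g s <= D * (B - f s)) ->
  f 0 <= B -> times T t -> f t <= B.
Proof.
move=> D0 df gle f0 Tt; have [t0 _] := Tt.
have : expR (D * t) * (f t - B) <= expR (D * 0) * (f 0 - B) + 0 * (t - 0).
  apply: (@dw_times_le _ T (fun s => expR (D * s) * (f s - B))
    (fun s => D * expR (D * s) * (f s - B) + expR (D * s) * (g s + 0))) => // [s Ts|s st].
    apply: dw_mul; first exact: dw_expR.
    by apply: dw_add; [exact: df | exact: dw_cst].
  have -> : D * expR (D * s) * (f s - B) + expR (D * s) * (g s + 0) =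
    expR (D * s) * (g s - D * (B - f s)) by ring.
  by rewrite mulr_ge0_le0 ?expR_ge0// subr_le0 gle.
rewrite mul0r addr0 mulr0 expR0 mul1r => H.
have : expR (D * t) * (f t - B) <= 0 by rewrite (le_trans H)// subr_le0.
by rewrite pmulr_rle0 ?expR_gt0// subr_le0.
Qed.

Lemma sum_geometric_le (z : R) n : 0 <= z < 1 -> \sum_(i < n) z ^+ i <= (1 - z)^-1.
Proof.
move=> /andP[z0 z1]; have z1' : 0 < 1 - z by rewrite subr_gt0.
rewrite -(@ler_pM2l _ (1 - z))// divff ?gt_eqF//.
have -> : (1 - z) * \sum_(i < n) z ^+ i = 1 - z ^+ n.
  by rewrite -opprB -[in RHS]opprB mulNr -subrX1.
by rewrite gerBl exprn_ge0.
Qed.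

(* The step inequality telescopes to bound the sum of the a n; the upper bound on
   Theta turns this into a bound on the sum of the Theta n, which decrease. *)
Lemma flux_decay (a Theta e : nat -> R) K (c S : R) : 0 <= c ->
  (forall n, 0 <= a n) ->
  (forall n, (n < K)%N -> a n.+1 + Theta n.+1 <= Theta n) ->
  (forall n, (n < K)%N -> 0 <= Theta n.+1 <= c * a n.+1 + e n) ->
  (forall n, \sum_(i < n) e i <= S) ->
  forall n, (n < K)%N -> n%:R * a n.+1 <= c * Theta 0 + S.
Proof.
move=> c0 a0 st Hth He n nK.
have sum_a m : (m <= K)%N -> \sum_(i < m) a i.+1 <= Theta 0 - Theta m.
  elim: m => [|m IHm] mK; first by rewrite big_ord0 subrr.
  rewrite big_ord_recr/=; have := IHm (ltnW mK); have := st m mK; lra.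
have mono m : (m <= n)%N -> Theta n <= Theta m.
  elim: n nK => [|n IHn] nK; first by rewrite leqn0 => /eqP ->.
  rewrite leq_eqVlt => /predU1P[->//|]; rewrite ltnS => mn.
  have := IHn (ltnW nK) mn; have := st n (ltnW nK); have := a0 n.+1; lra.
have H1 : a n.+1 <= Theta n.
  by have := st n nK; have /andP[] := Hth n nK; lra.
have H2 : n%:R * Theta n <= \sum_(i < n) Theta i.+1.
  rewrite mulr_natl -[X in _ *+ X]card_ord -sumr_const.
  by apply: ler_sum => i _; apply: mono.
have H3 : \sum_(i < n) Theta i.+1 <= \sum_(i < n) (c * a i.+1 + e i).
  apply: ler_sum => i _; have /andP[_] := Hth i (ltn_trans (ltn_ord i) nK); exact.
rewrite big_split/= -mulr_sumr in H3.
have H4 : c * (\sum_(i < n) a i.+1) <= c * Theta 0.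
  rewrite ler_wpM2l//; apply: le_trans (sum_a n (ltnW nK)) _.
  (* Non-negativity of [Theta] is assumed at positive indices only; at index 0 it follows from the
     step inequality. *)
  case: n nK {mono H1 H2 H3} => [|n] nK; last by have /andP[] := Hth n (ltnW nK); lra.
  have /andP[] := Hth 0%N nK; have := st 0%N nK; have := a0 1%N; lra.
have H5 : n%:R * a n.+1 <= n%:R * Theta n by rewrite ler_wpM2l.
have := He n; lra.
Qed.

End Regularity.

(** * Uniform decay for alpha >= 1/3 *)

Section Critical.
Variables (R : realType) (k0 d0 L q : R).
Hypotheses (k0_gt0 : 0 < k0) (d0_gt0 : 0 < d0) (L_gt1 : 1 < L).

(** The pointwise form of membership in every Sobolev space that the estimates use, with natural
    exponents only. *)
Definition rapid (h : nat -> R) := forall p, exists C, forall n, (L ^+ p) ^+ n * h n <= C.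

Let kc n : R := k0 * L ^+ n.
Let dc n : R := d0 * q ^+ n.

(** The coefficients are cut, not the state: shells beyond [K] remain, decoupled and merely damped,
    so truncated and full systems share all lemmas. *)
Definition truncate K (k : nat -> R) n : R := if (n < K)%N then k n else 0.

Hypotheses (q_gt2 : 2 < q) (Lq : L ^+ 2 <= q ^+ 3).

Variable h : nat -> R.
Hypotheses (h_ge0 : nonneg_seq h) (h_rapid : rapid h).

Let L_gt0 : 0 < L. Proof. by apply: lt_trans L_gt1. Qed.
Let q_gt0 : 0 < q. Proof. by apply: lt_trans q_gt2. Qed.
Let kc_gt0 n : 0 < kc n. Proof. by rewrite mulr_gt0// exprn_gt0. Qed.
Let dc_gt0 n : 0 < dc n. Proof. by rewrite mulr_gt0// exprn_gt0. Qed.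
Let kt_ge0 K n : 0 <= truncate K kc n.
Proof. by rewrite /truncate; case: ifP => // _; exact: ltW. Qed.
Let kt_le K n : truncate K kc n <= kc n.
Proof. by rewrite /truncate; case: ifP => // _; exact: ltW. Qed.
Let dc_ge0 n : 0 <= dc n. Proof. exact: ltW. Qed.

Lemma exists_expr_ge (x : R) : exists p, x <= L ^+ p.
Proof.
apply: contrapT => /forallNP H.
suff : (1 : R) <= 0 by rewrite ler10.
apply: (@geometric_le0 _ L^-1 x _ 0); first by rewrite invr_ge0 ltW//= invf_lt1.
move=> N _; rewrite exprVn ler_pdivlMl ?exprn_gt0// mulr1.
by have /negP := H N; rewrite -ltNge => /ltW.
Qed.

Lemma rapid_bound (x : R) : 0 <= x -> exists2 C, 0 <= C & forall n, x ^+ n * h n <= C.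
Proof.
move=> x0; have [p xp] := exists_expr_ge x; have [C HC] := h_rapid p.
exists C => [|n]; first by rewrite (le_trans _ (HC 0%N))// expr0 mul1r.
by rewrite (le_trans _ (HC n))// ler_wpM2r// lerXn2r// nnegrE// ltW// exprn_gt0.
Qed.

(** Bounds the initial time derivative. Because [G] does not depend on [K], neither do the constants
    derived from it. *)
Lemma rhs_truncate_bound : exists2 G, 0 <= G & forall K n, rhs (truncate K kc) dc h n ^+ 2 <= G.
Proof.
have [C0 C00 HC0] := @rapid_bound 1 ler01.
have {}HC0 n : h n <= C0 by have := HC0 n; rewrite expr1n mul1r.
have [C1 C10 HC1] := rapid_bound (ltW L_gt0).
have [C2 C20 HC2] := rapid_bound (ltW q_gt0).
pose G := k0 * (C1 * C0) + k0 * (C1 * C0) + d0 * C2.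
have kb K n x : 0 <= x <= C0 -> 0 <= truncate K kc n * h n * x <= k0 * (C1 * C0).
  move=> /andP[x0 xC]; rewrite !mulr_ge0//=.
  apply: (@le_trans _ _ (kc n * h n * x)).
    by rewrite ler_wpM2r// ler_wpM2r.
  rewrite /kc -!mulrA; apply: ler_wpM2l; first exact: ltW.
  by rewrite mulrA ler_pM// mulr_ge0// ltW// exprn_gt0.
have db n : 0 <= dc n * h n <= d0 * C2.
  by rewrite mulr_ge0//= /dc -mulrA ler_wpM2l// ltW.
exists (G ^+ 2); first exact: sqr_ge0.
move=> K n; rewrite -subr_ge0 subr_sqr.
suff : - G <= rhs (truncate K kc) dc h n <= G.
  by move=> /andP[H1 H2]; apply: mulr_ge0; [rewrite subr_ge0|rewrite addrC -[X in _ + X]opprK subr_ge0].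
have in0C m : 0 <= h m <= C0 by rewrite h_ge0 HC0.
have := kb K n _ (in0C n.+1); have := db n.
case: n => [|n]; rewrite /rhs /inflow /G.
  have : 0 <= k0 * (C1 * C0) by apply: mulr_ge0; [exact: ltW | exact: mulr_ge0].
  lra.
have := kb K n _ (in0C n); rewrite expr2 mulrA; lra.
Qed.

(** * Flux estimates for one truncated solution at a fixed time *)

Section Solution.
Variables (K : nat) (u : R -> nat -> R) (G : R).
Hypothesis (u_sol : shell_solution (truncate K kc) dc h +oo u).
Hypothesis rhsG : forall n, rhs (truncate K kc) dc h n ^+ 2 <= G.
Variable t : R.
Hypothesis t_ge0 : 0 <= t.

Let u_ge0 n : 0 <= u t n.
Proof. by have [H _ _] := u_sol; apply: H; apply/times_pinfty. Qed.

Let f n := rhs (truncate K kc) dc (u t) n.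

Lemma rhs_sqr_le n : (n <= K)%N -> f n ^+ 2 <= 2 ^+ n * (2 * G).
Proof.
move=> nK.
have kK : truncate K kc K = 0 by rewrite /truncate ltnn.
have H := sum_half_pow_rhs_le (kt_ge0 K) dc_ge0 kK u_sol t_ge0.
have h0 i : 0 <= (2^-1 : R) ^+ i by rewrite exprn_ge0// invr_ge0.
have S : \sum_(i < K.+1) 2^-1 ^+ i * rhs (truncate K kc) dc h i ^+ 2 <= 2 * G.
  apply: (@le_trans _ _ (\sum_(i < K.+1) 2^-1 ^+ i * G)).
    by apply: ler_sum => i _; rewrite ler_wpM2l.
  rewrite -mulr_suml ler_wpM2r//; first exact: le_trans (sqr_ge0 _) (rhsG 0%N).
  apply: le_trans (sum_geometric_le _ _) _.
    by rewrite invr_ge0 ler0n/= invf_lt1// ltr1n.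
  by rewrite (_ : 1 - 2^-1 = 2^-1 :> R) ?invrK//; field.
rewrite -ler_pdivrMl ?exprn_gt0// -exprVn; apply: le_trans (le_trans H S).
apply: (@ler_term_sum _ (fun i => 2^-1 ^+ i * f i ^+ 2)) => // i.
by rewrite mulr_ge0// sqr_ge0.
Qed.

Let r := 2 / q.
Let E := G / d0.
Let P n := truncate K kc n * u t n ^+ 2 * u t n.+1.
(** [E * r ^+ n.+1] is the cost of the time derivative in passing from shell n to n + 1. Adding to
    the flux the sum of all costs still to come makes [Theta] non-increasing without error. *)
Let Theta n := P n + E * r ^+ n.+1 / (1 - r).

Let r_ge0 : 0 <= r. Proof. by rewrite divr_ge0// ltW. Qed.
Let r_lt1 : r < 1. Proof. by rewrite ltr_pdivrMr// mul1r. Qed.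
Let P_ge0 n : 0 <= P n. Proof. by rewrite !mulr_ge0// sqr_ge0. Qed.

(** The equation of shell n + 1 times u_(n+1) is a flux balance with defect f_(n+1) u_(n+1). Young's
    inequality charges half of the dissipation for the defect and leaves f^2 / (2 d). *)
Lemma flux_step n : (n < K)%N -> dc n.+1 * u t n.+1 ^+ 2 / 2 + Theta n.+1 <= Theta n.
Proof.
move=> nK; have fle := rhs_sqr_le nK.
have E0 : f n.+1 * u t n.+1 = P n - P n.+1 - dc n.+1 * u t n.+1 ^+ 2.
  by rewrite /f /rhs /inflow /P; ring.
have d1 := dc_gt0 n.+1.
have Hf : - (f n.+1 * u t n.+1) <= dc n.+1 * u t n.+1 ^+ 2 / 2 + f n.+1 ^+ 2 / (2 * dc n.+1).
  rewrite -subr_ge0.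
  have -> : dc n.+1 * u t n.+1 ^+ 2 / 2 + f n.+1 ^+ 2 / (2 * dc n.+1) -
    - (f n.+1 * u t n.+1) = (dc n.+1 * u t n.+1 + f n.+1) ^+ 2 / (2 * dc n.+1).
    by field; rewrite gt_eqF.
  by rewrite divr_ge0 ?sqr_ge0// mulr_ge0// ltW.
have HE : f n.+1 ^+ 2 / (2 * dc n.+1) <= E * r ^+ n.+1.
  have D2 : 0 < 2 * dc n.+1 by rewrite mulr_gt0.
  rewrite ler_pdivrMr//; apply: (le_trans fle).
  rewrite /E /r /dc exprMn exprVn.
  have -> : G / d0 * (2 ^+ n.+1 / q ^+ n.+1) * (2 * (d0 * q ^+ n.+1)) =
    2 ^+ n.+1 * (2 * G) by field; rewrite gt_eqF ?exprn_gt0// gt_eqF.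
  exact: lexx.
have HT : E * r ^+ n.+2 / (1 - r) + E * r ^+ n.+1 = E * r ^+ n.+1 / (1 - r).
  by rewrite (exprS _ n.+1); field; rewrite subr_eq0 gt_eqF.
rewrite /Theta; lra.
Qed.

Let P0 := k0 * h 0%N ^+ 2 * (h 0%N + h 1%N) + E * r ^+ 1 / (1 - r).

Let G_ge0 : 0 <= G. Proof. exact: le_trans (sqr_ge0 _) (rhsG 0%N). Qed.
Let E_ge0 : 0 <= E. Proof. by rewrite divr_ge0// ltW. Qed.
Let tail_ge0 n : 0 <= E * r ^+ n / (1 - r).
Proof.
apply: divr_ge0; last by rewrite subr_ge0 ltW.
by apply: mulr_ge0 => //; exact: exprn_ge0.
Qed.

(** The energies of the first one and two shells give u_0 <= h_0 and u_1 <= h_0 + h_1. *)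
Lemma Theta0_le : Theta 0 <= P0.
Proof.
have [_ _ uh] := u_sol.
have en N := energy_le N (kt_ge0 K) dc_ge0 u_sol (lexx 0) t_ge0 (proj2 (times_pinfty t) t_ge0).
have := en 1%N; have := en 2%N; rewrite !big_ord_recr !big_ord0/= !add0r !uh => e2 e1.
rewrite /Theta /P0 lerD2r /P.
have h00 := h_ge0 0%N; have h10 := h_ge0 1%N.
have u1 : u t 1%N <= h 0%N + h 1%N.
  rewrite -(@ler_pXn2r _ 2) ?nnegrE ?addr_ge0//.
  have := sqr_ge0 (u t 0%N); have : 0 <= h 0%N * h 1%N by rewrite mulr_ge0.
  rewrite sqrrD -mulr_natr; lra.
apply: ler_pM => //; first by rewrite mulr_ge0 ?sqr_ge0.
apply: ler_pM => //; first by rewrite sqr_ge0.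
by apply: le_trans (kt_le _ _) _; rewrite /kc expr0 mulr1.
Qed.

Lemma Theta_le n : (n <= K)%N -> Theta n <= P0.
Proof.
elim: n => [|n IHn] nK; first exact: Theta0_le.
have := flux_step nK; have := IHn (ltnW nK).
have : 0 <= dc n.+1 * u t n.+1 ^+ 2 / 2 by rewrite divr_ge0// mulr_ge0// sqr_ge0.
lra.
Qed.

Lemma dissipation_le n : (n < K)%N -> dc n.+1 * u t n.+1 ^+ 2 <= 2 * P0.
Proof.
move=> nK; have := flux_step nK; have := Theta_le (ltnW nK).
have : 0 <= Theta n.+1 by rewrite addr_ge0.
lra.
Qed.

Let c5 := Num.sqrt (2 * P0 / (d0 * q)) * (k0 / d0).

(** The critical exponent enters here. By [dissipation_le], u_(n+2)^2 <= 2 P0 / d_(n+2), and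
    k_(n+1)^2 / (d_(n+1)^2 d_(n+2)) is of order (L^2 / q^3)^n. In the last case, n + 1 = K, the flux
    is zero. *)
Lemma flux_le n : (n < K)%N -> P n.+1 <= c5 * (dc n.+1 * u t n.+1 ^+ 2).
Proof.
move=> nK; have P00 : 0 <= P0 by apply: le_trans (Theta_le (leq0n K)); rewrite addr_ge0.
have c50 : 0 <= c5 by rewrite mulr_ge0 ?sqrtr_ge0// divr_ge0// ltW.
rewrite /P /truncate; case: ltnP => [n1K|_]; last first.
  by rewrite !mul0r mulr_ge0// mulr_ge0// sqr_ge0.
rewrite mulrAC [X in _ <= X]mulrA ler_wpM2r ?sqr_ge0//.
have kcu : 0 <= kc n.+1 * u t n.+2 by rewrite mulr_ge0// ltW.
have c5d : 0 <= c5 * dc n.+1 by rewrite mulr_ge0.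
rewrite -(@ler_pXn2r _ 2) ?nnegrE//.
have D := dissipation_le n1K.
have d2 := dc_gt0 n.+2.
rewrite exprMn; apply: (@le_trans _ _ (kc n.+1 ^+ 2 * (2 * P0 / dc n.+2))).
  by rewrite ler_wpM2l ?sqr_ge0// ler_pdivlMr// mulrC.
rewrite /c5 !exprMn sqr_sqrtr; last first.
  by apply: divr_ge0; [exact: mulr_ge0 | rewrite ltW// mulr_gt0].
rewrite /kc /dc ?exprMn exprVn.
set x := L ^+ n.+1; set y := q ^+ n.+1.
have y0 : 0 < y by rewrite exprn_gt0.
have xy : x ^+ 2 <= y ^+ 3.
  by rewrite -!exprM mulnC [X in _ <= _ ^+ X]mulnC !exprM lerXn2r// nnegrE exprn_ge0// ltW.
have -> : k0 ^+ 2 * x ^+ 2 * (2 * P0 / (d0 * q ^+ n.+2)) =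
  2 * P0 / (d0 * q * y) * k0 ^+ 2 * x ^+ 2.
  by rewrite (exprS q n.+1) -/y; field; rewrite !gt_eqF.
have -> : 2 * P0 / (d0 * q) * (k0 ^+ 2 / d0 ^+ 2) * (d0 ^+ 2 * y ^+ 2) =
  2 * P0 / (d0 * q * y) * k0 ^+ 2 * y ^+ 3 by field; rewrite !gt_eqF.
apply: ler_wpM2l => //; apply: mulr_ge0; last exact: sqr_ge0.
by apply: divr_ge0; [exact: mulr_ge0 | rewrite ltW// !mulr_gt0].
Qed.

Let S0 := E / (1 - r) ^+ 2.

Lemma shell_decay n : (n < K)%N ->
  n%:R * (dc n.+1 * u t n.+1 ^+ 2) <= 2 * (2 * c5 * P0 + S0).
Proof.
move=> nK.
have P00 : 0 <= P0 by apply: le_trans (Theta_le (leq0n K)); rewrite addr_ge0.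
have c50 : 0 <= c5 by rewrite mulr_ge0 ?sqrtr_ge0// divr_ge0// ltW.
have r1 : 0 < 1 - r by rewrite subr_gt0.
have H : n%:R * (dc n.+1 * u t n.+1 ^+ 2 / 2) <= 2 * c5 * Theta 0 + S0.
  (* The constant is [2 * c5] because the decrement is half of the dissipation; the errors are the
     tails contained in [Theta n.+1], with sum at most [S0]. *)
  apply: (@flux_decay _ (fun n => dc n * u t n ^+ 2 / 2) Theta
    (fun n => E * r ^+ n.+2 / (1 - r)) K) => //.
  - by rewrite mulr_ge0.
  - by move=> m; rewrite divr_ge0// mulr_ge0// sqr_ge0.
  - exact: flux_step.
  - move=> m mK; rewrite addr_ge0//= /Theta.
    by have := flux_le mK; lra.
  - move=> m; rewrite /S0 expr2 invfM mulrA.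
    apply: (@le_trans _ _ (E / (1 - r) * \sum_(i < m) r ^+ i)).
      rewrite mulr_sumr; apply: ler_sum => i _; rewrite mulrAC ler_wpM2l//.
        by rewrite divr_ge0// ltW.
      by apply: ler_wiXn2l => //; [exact: ltW | exact: (leq_addl 2)].
    apply: ler_wpM2l; first by rewrite divr_ge0// ltW.
    by apply: sum_geometric_le; rewrite r_ge0.
have H2 : 2 * c5 * Theta 0 <= 2 * c5 * P0.
  by apply: ler_wpM2l Theta0_le; exact: mulr_ge0.
have -> : n%:R * (dc n.+1 * u t n.+1 ^+ 2) =
  2 * (n%:R * (dc n.+1 * u t n.+1 ^+ 2 / 2)) by field.
by rewrite ler_pM2l// (le_trans H)// lerD2r.
Qed.
End Solution.

Lemma truncated_decay : exists2 S, 0 <= S & forall K u t n,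
  shell_solution (truncate K kc) dc h +oo u -> 0 <= t -> (n < K)%N ->
  n%:R * (dc n.+1 * u t n.+1 ^+ 2) <= S.
Proof.
have [G G0 HG] := rhs_truncate_bound.
set D := fun S => forall K u t n,
  shell_solution (truncate K kc) dc h +oo u -> 0 <= t -> (n < K)%N ->
  n%:R * (dc n.+1 * u t n.+1 ^+ 2) <= S.
(* The witness is the bound of [shell_decay]. It is fixed before [K], [u] and [t] are introduced,
   hence is uniform in them. *)
have [S HS] : exists S, D S.
  by eexists => K u t n hu t0 nK; apply: (shell_decay hu (HG K) t0 nK).
exists (Num.max S 0) => [|K u t n hu t0 nK]; first by rewrite le_max lexx orbT.
by rewrite le_max (HS K u t n).
Qed.

Lemma exists_nat_ge (x : R) : exists n : nat, x <= n%:R.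
Proof. by exists (Num.truncn x).+1; exact/ltW/truncnS_gt. Qed.

(** When L^2 = q^3 all powers of L and q cancel in (k_n u_n / d_(n+1))^2, and the factor 1/n from
    the decay of the dissipation is the only gain. [N] is the index from which this factor beats
    [eta]. *)
Lemma truncated_quasilinear (eta : R) : 0 < eta -> exists N, forall K u t n,
  shell_solution (truncate K kc) dc h +oo u -> 0 <= t -> (N <= n)%N -> (n < K)%N ->
  kc n.+1 * u t n.+1 <= eta * dc n.+2.
Proof.
move=> eta0; have [S S0 HS] := truncated_decay.
have X0 : 0 < eta ^+ 2 * d0 ^+ 3 * q ^+ 2 by rewrite !mulr_gt0// exprn_gt0.
have [N HN] := exists_nat_ge (k0 ^+ 2 * S / (eta ^+ 2 * d0 ^+ 3 * q ^+ 2)).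
exists N.+1 => K u t n hu t0 Nn nK.
have u0 : 0 <= u t n.+1 by have [H _ _] := hu; apply: H; apply/times_pinfty.
have kcu : 0 <= kc n.+1 * u t n.+1 by rewrite mulr_ge0// ltW.
have ed : 0 <= eta * dc n.+2 by rewrite mulr_ge0// ltW.
rewrite -(@ler_pXn2r _ 2) ?nnegrE//.
have := HS K u t n hu t0 nK; rewrite /kc /dc.
rewrite (exprS q n.+1); set x := L ^+ n.+1; set y := q ^+ n.+1 => H.
have y0 : 0 < y by rewrite exprn_gt0.
have xy : x ^+ 2 <= y ^+ 3.
  by rewrite -!exprM mulnC [X in _ <= _ ^+ X]mulnC !exprM lerXn2r// nnegrE exprn_ge0// ltW.
have n0 : 0 < n%:R :> R by rewrite ltr0n (leq_trans _ Nn).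
have m0 : 0 < n%:R * (d0 * y) by rewrite mulr_gt0// mulr_gt0.
rewrite -(ler_pM2l m0).
have -> : n%:R * (d0 * y) * (k0 * x * u t n.+1) ^+ 2 =
  n%:R * (d0 * y * u t n.+1 ^+ 2) * (k0 ^+ 2 * x ^+ 2) by ring.
apply: (@le_trans _ _ (S * (k0 ^+ 2 * y ^+ 3))).
  apply: ler_pM => //; first by rewrite mulr_ge0// mulr_ge0 ?sqr_ge0// mulr_ge0// ltW.
    by rewrite mulr_ge0 ?sqr_ge0.
  by rewrite ler_wpM2l// sqr_ge0.
have -> : n%:R * (d0 * y) * (eta * (d0 * (q * y))) ^+ 2 =
  n%:R * (eta ^+ 2 * d0 ^+ 3 * q ^+ 2) * y ^+ 3 by ring.
rewrite [X in X <= _]mulrA; apply: ler_wpM2r; first by rewrite exprn_ge0// ltW.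
rewrite mulrC -ler_pdivrMr//; apply: (le_trans HN).
by rewrite ler_nat (leq_trans _ Nn).
Qed.

(* From some shell on the equations are dominated by
   u_(n+1)' <= d_(n+1) (L^-p u_n - u_(n+1)). *)
Lemma truncated_rapid p : exists C, forall K u t n,
  shell_solution (truncate K kc) dc h +oo u -> 0 <= t ->
  (L ^+ p) ^+ n * u t n <= C.
Proof.
have Lp0 : 0 < L ^+ p by rewrite exprn_gt0.
have [N HN] := @truncated_quasilinear (L ^+ p)^-1 ltac:(by rewrite invr_gt0).
have [C C0 HC] := rapid_bound (ltW Lp0).
(* Covers the shells up to N + 1: by the energy of the first N + 2 shells, each u_n there is at most
   the sum of their initial values. *)
pose M := (L ^+ p) ^+ N.+1 * \sum_(i < N.+2) h i.
have M0 : 0 <= M.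
  by apply: mulr_ge0; [rewrite exprn_ge0// ltW | exact: sumr_ge0].
exists (C + M) => K u t n hu t0; have [u0 du uh] := hu.
have CM0 : 0 <= C + M by rewrite addr_ge0.
have {}HC m : h m <= (C + M) / (L ^+ p) ^+ m.
  by rewrite ler_pdivlMr ?exprn_gt0// mulrC (le_trans (HC m))// lerDl.
elim: n t t0 => [|n IHn] t t0.
  have := energy_le 1 (kt_ge0 K) dc_ge0 hu (lexx 0) t0 (proj2 (times_pinfty t) t0).
  rewrite !big_ord_recr !big_ord0/= !add0r uh ler_pXn2r ?nnegrE//; last first.
    by apply: u0; apply/times_pinfty.
  by rewrite expr0 mul1r => /le_trans; apply; have := HC 0%N; rewrite expr0 divr1.
have [nN|Nn] := leqP n N.
  have un : 0 <= u t n.+1 by apply: u0; apply/times_pinfty.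
  have S0 : 0 <= \sum_(i < N.+2) h i by apply: sumr_ge0.
  apply: (@le_trans _ _ M); last by rewrite lerDr.
  apply: ler_pM => //; first by rewrite exprn_ge0// ltW.
    by apply: ler_weXn2l => //; rewrite exprn_ege1// ltW.
  rewrite -(@ler_pXn2r _ 2) ?nnegrE//.
  apply: (@le_trans _ _ (\sum_(i < N.+2) h i ^+ 2)).
    apply: le_trans (_ : \sum_(i < N.+2) u t i ^+ 2 <= _).
      by apply: (@ler_term_sum _ (fun i => u t i ^+ 2)) => // i; exact: sqr_ge0.
    have := energy_le N.+2 (kt_ge0 K) dc_ge0 hu (lexx 0) t0 (proj2 (times_pinfty t) t0).
    by under [X in _ <= X]eq_bigr do rewrite uh.
  rewrite expr2 mulr_suml; apply: ler_sum => i _; rewrite expr2 ler_wpM2l//.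
  exact: (@ler_term_sum _ h).
rewrite mulrC -ler_pdivlMr ?exprn_gt0//.
apply: (@dw_relax _ +oo (fun s => u s n.+1) (fun s => rhs (truncate K kc) dc (u s) n.+1) (dc n.+1)) => //.
- by move=> s Ts; exact: du.
- move=> s /andP[s0 _]; rewrite /rhs /inflow mulrBr.
  have us m : 0 <= u s m by apply: u0; apply/times_pinfty.
  have H1 : 0 <= truncate K kc n.+1 * u s n.+1 * u s n.+2 by rewrite !mulr_ge0.
  suff : truncate K kc n * u s n ^+ 2 <= dc n.+1 * ((C + M) / (L ^+ p) ^+ n.+1) by lra.
  rewrite /truncate; case: ltnP => nK; last first.
    by rewrite mul0r mulr_ge0// divr_ge0// exprn_ge0// ltW.
  case: n Nn nK IHn {H1 t t0} => // n Nn nK IHn.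
  have := HN K u s n hu s0 Nn (ltnW nK); have := IHn s s0 => H2 H3.
  rewrite expr2 mulrA; apply: (le_trans (ler_wpM2r (us n.+1) H3)).
  rewrite -mulrA mulrCA ler_wpM2l// exprS invfM mulrCA ler_wpM2l ?invr_ge0 ?(ltW Lp0)//.
  by rewrite ler_pdivlMr ?exprn_gt0// mulrC.
- by rewrite uh.
- exact/times_pinfty.
Qed.
End Critical.

(** * Existence by Euler and Galerkin approximation *)

Section QuadraticSolutions.
Variables (R : realType) (k d M : nat -> R).
Hypotheses (k_ge0 : forall n, 0 <= k n) (d_ge0 : forall n, 0 <= d n).
Implicit Types (x y W kk : nat -> R).

Definition in_box x := forall n, 0 <= x n <= M n.

Definition rhs_bound n : R := inflow k M n + k n * M n * M n.+1 + d n * M n.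

(** Modulus of [rhs] at shell n when each coordinate m moves with speed at most [W m]. It is kept
    coordinatewise because the coefficients may grow with n. *)
Definition rhs_lip W n : R :=
  (if n is m.+1 then 2 * k m * M m * W m else 0) +
  k n * (M n.+1 * W n + M n * W n.+1) + d n * W n.

(** Lets bounds computed from [k] serve the full system and all its truncations alike. *)
Definition subcoef kk := forall n, 0 <= kk n <= k n.

Lemma inflow_le kk x n : subcoef kk -> in_box x ->
  0 <= inflow kk x n <= inflow k M n.
Proof.
move=> hk hx; case: n => [|n] /=; first by rewrite lexx.
have /andP[kk0 kkn] := hk n; have /andP[x0 xM] := hx n.
rewrite mulr_ge0 ?sqr_ge0//=; apply: ler_pM => //; first exact: sqr_ge0.
by rewrite lerXn2r// nnegrE// (le_trans x0).
Qed.

Lemma outgoing_le kk a b n : subcoef kk -> 0 <= a <= M n -> 0 <= b <= M n.+1 ->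
  0 <= kk n * a * b <= k n * M n * M n.+1.
Proof.
move=> hk /andP[a0 aM] /andP[b0 bM]; have /andP[kk0 kkn] := hk n.
by rewrite !mulr_ge0//=; apply: ler_pM => //; [exact: mulr_ge0|exact: ler_pM].
Qed.

Lemma rhs_norm_le kk x n : subcoef kk -> in_box x -> `|rhs kk d x n| <= rhs_bound n.
Proof.
move=> hk hx; have /andP[i0 iM] := inflow_le n hk hx.
have /andP[p0 pM] := outgoing_le hk (hx n) (hx n.+1).
have dx0 : 0 <= d n * x n by rewrite mulr_ge0//; have /andP[] := hx n.
have dxM : d n * x n <= d n * M n by rewrite ler_wpM2l//; have /andP[] := hx n.
rewrite /rhs /rhs_bound ler_norml; apply/andP; split; lra.
Qed.

Lemma rhs_lip_le kk x y W s n : subcoef kk -> in_box x -> in_box y ->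
  (forall m, `|y m - x m| <= s * W m) ->
  `|rhs kk d y n - rhs kk d x n| <= s * rhs_lip W n.
Proof.
move=> hk hx hy H.
have kk0 m : 0 <= kk m by have /andP[] := hk m.
have kkk m : kk m <= k m by have /andP[] := hk m.
have sW m : 0 <= s * W m by exact: le_trans (H m).
have xM m : `|x m| <= M m by have /andP[? ?] := hx m; rewrite ger0_norm.
have yM m : `|y m| <= M m by have /andP[? ?] := hy m; rewrite ger0_norm.
have M0 m : 0 <= M m by exact: le_trans (xM m).
have HI : `|inflow kk y n - inflow kk x n| <=
    (if n is m.+1 then 2 * k m * M m * (s * W m) else 0).
  case: (n) => [|m] /=; first by rewrite subrr normr0.
  have -> : kk m * y m ^+ 2 - kk m * x m ^+ 2 = (kk m * (y m + x m)) * (y m - x m) by ring.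
  rewrite normrM; apply: ler_pM => //; rewrite normrM (ger0_norm (kk0 m)).
  have -> : 2 * k m * M m = k m * (M m + M m) by ring.
  by apply: ler_pM => //; apply: le_trans (ler_normD _ _) _; exact: lerD.
have HO : `|kk n * y n * y n.+1 - kk n * x n * x n.+1| <=
    k n * (M n.+1 * (s * W n) + M n * (s * W n.+1)).
  have -> : kk n * y n * y n.+1 - kk n * x n * x n.+1 =
    kk n * (y n.+1 * (y n - x n) + x n * (y n.+1 - x n.+1)) by ring.
  rewrite normrM (ger0_norm (kk0 n)); apply: ler_pM => //.
  apply: le_trans (ler_normD _ _) _; rewrite !normrM.
  by apply: lerD; apply: ler_pM.
have HD : `|d n * y n - d n * x n| <= d n * (s * W n).
  by rewrite -mulrBr normrM (ger0_norm (d_ge0 n)) ler_wpM2l.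
have -> : s * rhs_lip W n =
   (if n is m.+1 then 2 * k m * M m * (s * W m) else 0) +
   k n * (M n.+1 * (s * W n) + M n * (s * W n.+1)) + d n * (s * W n).
  by rewrite /rhs_lip; case: (n) => [|m]; ring.
have -> : rhs kk d y n - rhs kk d x n = (inflow kk y n - inflow kk x n) -
    (kk n * y n * y n.+1 - kk n * x n * x n.+1) - (d n * y n - d n * x n).
  by rewrite /rhs; ring.
apply: le_trans (ler_normB _ _) _; apply: lerD => //.
by apply: le_trans (ler_normB _ _) _; apply: lerD.
Qed.

(* A formulation of the equations without derivatives, stable under pointwise limits. *)
Definition quadratic_solution kk h (C : nat -> R) (u : R -> nat -> R) : Prop :=
  [/\ forall t, 0 <= t -> in_box (u t),
      forall n s t, 0 <= t -> t <= s ->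
        `|u s n - u t n - (s - t) * rhs kk d (u t) n| <= C n * (s - t) ^+ 2
    & forall n, u 0 n = h n].

(** The quadratic estimate looks forward in time. For s < t it is applied from s, and the Lipschitz
    bound then moves the right-hand side from s to t. *)
Lemma quadratic_solution_shell kk h C u : subcoef kk -> (forall n, 0 <= C n) ->
  quadratic_solution kk h C u -> shell_solution kk d h +oo u.
Proof.
move=> hk C0 [ub uC uh]; split=> [t /times_pinfty t0 n|n t /times_pinfty t0|]//.
  by have /andP[] := ub t t0 n.
have M0 m : 0 <= M m by have /andP[x0 xM] := ub t t0 m; exact: le_trans x0 xM.
have B0 m : 0 <= rhs_bound m by exact: le_trans (rhs_norm_le m hk (ub t t0)).
(* Over times at most 1 the quadratic error is at most linear, so [W m] bounds the speed of
   coordinate m. *)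
pose W m := rhs_bound m + C m.
have W0 m : 0 <= W m by rewrite addr_ge0.
pose L := rhs_lip W n.
have L0 : 0 <= L.
  rewrite /L /rhs_lip addr_ge0 ?mulr_ge0// addr_ge0 ?mulr_ge0 ?addr_ge0 ?mulr_ge0//.
  by case: (n) => // m; rewrite !mulr_ge0.
apply/dwP => e e0.
have CL : 0 < C n + L + 1 by rewrite ltr_wpDl// addr_ge0.
exists (Num.min 1 (e / (C n + L + 1))); first by rewrite lt_min ltr01 divr_gt0.
move=> s /times_pinfty s0; rewrite lt_min => /andP[st1 ste].
apply: (@le_trans _ _ ((C n + L) * `|s - t| ^+ 2)); last first.
  rewrite expr2 mulrA ler_wpM2r//; apply: ltW; apply: le_lt_trans (_ : (C n + L + 1) * `|s - t| < e).
    by rewrite ler_wpM2r// lerDl ler01.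
  by rewrite mulrC -ltr_pdivlMr.
rewrite real_normK ?num_real// [_ * (s - t)]mulrC.
have [ts|st] := leP t s.
  by apply: le_trans (uC n s t t0 ts) _; rewrite ler_wpM2r ?sqr_ge0// lerDl.
have ts0 : 0 <= t - s by rewrite subr_ge0 ltW.
have ts1 : t - s <= 1.
  by move: st1; rewrite distrC ger0_norm// => /ltW.
have H m : `|u t m - u s m| <= (t - s) * W m.
  rewrite -[u t m - u s m](subrK ((t - s) * rhs kk d (u s) m)).
  apply: le_trans (ler_normD _ _) _; rewrite [X in _ <= X]mulrDr [X in X <= _]addrC; apply: lerD.
    by rewrite normrM (ger0_norm ts0) ler_wpM2l// rhs_norm_le//; exact: ub.
  apply: le_trans (uC m t s s0 (ltW st)) _.
  by rewrite mulrC expr2 -mulrA ler_wpM2l// ler_piMl.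
have E : u s n - u t n - (s - t) * rhs kk d (u t) n =
  - (u t n - u s n - (t - s) * rhs kk d (u s) n) + (t - s) * (rhs kk d (u t) n - rhs kk d (u s) n).
  by ring.
rewrite E; apply: le_trans (ler_normD _ _) _; rewrite normrN [X in _ <= X]mulrDl.
have -> : (s - t) ^+ 2 = (t - s) ^+ 2 by ring.
apply: lerD; first exact: uC (ltW st).
rewrite normrM (ger0_norm ts0) [X in _ <= X]mulrC expr2 -mulrA ler_wpM2l//.
by apply: rhs_lip_le => //; exact: ub.
Qed.
End QuadraticSolutions.

Section Existence.
Variables (R : realType) (k d M : nat -> R).
Hypotheses (k_ge0 : forall n, 0 <= k n) (d_ge0 : forall n, 0 <= d n).
Implicit Types (x kk h C : nat -> R).

Local Notation in_box := (in_box M).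
Local Notation subcoef := (subcoef k).
Local Notation rhs_bound := (rhs_bound k d M).
Local Notation rhs_lip := (rhs_lip k d M).
Local Notation quadratic_solution := (quadratic_solution d M).

Lemma ultra_cvg (U : set_system nat) (a : nat -> R) A B : UltraFilter U ->
  (forall m, A <= a m <= B) -> exists l : R, a @ U --> l.
Proof.
move=> UF aAB; have UP := @ultra_proper _ _ UF.
have aU : (a @ U) `[A, B]%classic by apply: nearW => m; rewrite /= in_itv/=.
have [l [_ cl]] := @segment_compact R A B (a @ U) _ aU.
exists l; apply/cvgrPdist_lt => e e0.
have [//|H] := in_ultra_setVsetC (fun m => `|l - a m| < e) UF.
have nl : nbhs (l : R) [set y : R | `|l - y| < e] by exists e.
by have [y [/= yn yp]] := cl (~` [set y : R | `|l - y| < e]) _ H nl.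
Qed.

(** Along an ultrafilter finer than \oo the bounded values [w m t n] converge for all t and n at
    once, in place of a diagonal subsequence. The second conclusion transports eventual upper bounds
    to the limit. *)
Lemma quadratic_limit kk h C (w : nat -> R -> nat -> R) : subcoef kk ->
  (forall m t, 0 <= t -> in_box (w m t)) -> (forall m n, w m 0 n = h n) ->
  (forall n s t e, 0 <= t -> t <= s -> 0 < e -> \forall m \near \oo,
    `|w m s n - w m t n - (s - t) * rhs kk d (w m t) n| <= C n * (s - t) ^+ 2 + e) ->
  exists2 u, quadratic_solution kk h C u & forall t n b, 0 <= t ->
    (\forall m \near \oo, w m t n <= b) -> u t n <= b.
Proof.
move=> hk wM wh wC.
have [U [UF sU]] := @ultraFilterLemma nat \oo _.
have UP := @ultra_proper _ _ UF.
have /choice[u Hu] : forall p : R * nat, exists l : R,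
    0 <= p.1 -> w m p.1 p.2 @[m --> U] --> l.
  move=> [t n] /=; have [t0|] := pselect (0 <= t); last by exists 0.
  have [l Hl] := @ultra_cvg U (fun m => w m t n) 0 (M n) UF (fun m => wM m t t0 n).
  by exists l.
have {}Hu t n : 0 <= t -> w m t n @[m --> U] --> u (t, n) by move=> t0; exact: (Hu (t, n)).
exists (fun t n => u (t, n)); last first.
  by move=> t n b t0 H; apply: ler_cvg_to (Hu t n t0) (cvg_cst b) (sU _ H).
split=> [t t0 n|n s t t0 ts|n].
- apply/andP; split.
    apply: ler_cvg_to (cvg_cst 0) (Hu t n t0) _.
    by apply: nearW => m; have /andP[] := wM m t t0 n.
  apply: ler_cvg_to (Hu t n t0) (cvg_cst (M n)) _.
  by apply: nearW => m; have /andP[] := wM m t t0 n.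
- have Hi : inflow kk (w m t) n @[m --> U] --> inflow kk (fun n => u (t, n)) n.
    case: n => [|n] /=; first exact: cvg_cst.
    apply: cvgM; first exact: cvg_cst.
    exact: (cvg_comp _ _ (Hu t n t0) (@exprn_continuous R 2 _)).
  have Hr : rhs kk d (w m t) n @[m --> U] --> rhs kk d (fun n => u (t, n)) n.
    apply: cvgB; last exact: cvgM (cvg_cst _) (Hu t n t0).
    by apply: cvgB Hi _; apply: cvgM (Hu t n.+1 t0); apply: cvgM (cvg_cst _) (Hu t n t0).
  have H1 : `|w m s n - w m t n - (s - t) * rhs kk d (w m t) n| @[m --> U] -->
     `|u (s, n) - u (t, n) - (s - t) * rhs kk d (fun n => u (t, n)) n|.
    apply: cvg_norm; apply: cvgB; last exact: cvgM (cvg_cst _) Hr.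
    by apply: cvgB (Hu t n t0); apply: Hu; exact: le_trans ts.
  apply/ler_addgt0Pr => e e0.
  exact: ler_cvg_to H1 (cvg_cst _) (sU _ (wC n s t e t0 ts e0)).
- apply/eqP; rewrite eq_le; apply/andP; split.
    by apply: ler_cvg_to (Hu 0 n (lexx 0)) (cvg_cst (h n)) _; apply: nearW => m; rewrite wh.
  by apply: ler_cvg_to (cvg_cst (h n)) (Hu 0 n (lexx 0)) _; apply: nearW => m; rewrite wh.
Qed.

Section Euler.
Variables (kk : nat -> R).
Hypotheses (kk_sub : subcoef kk) (M_ge0 : forall n, 0 <= M n).
Hypothesis M_inv : forall n, inflow k M n <= d n * M n.

(* Implicit in the damped unknown only, which keeps the box of bounds M invariant. *)
Definition euler_step tau x n : R :=
  (x n + tau * inflow kk x n) / (1 + tau * (kk n * x n.+1 + d n)).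

Let kk_ge0 n : 0 <= kk n. Proof. by have /andP[] := kk_sub n. Qed.

Definition euler_rate n := k n * M n.+1 + d n.

Let rate_ge0 x n : in_box x -> 0 <= kk n * x n.+1 + d n <= euler_rate n.
Proof.
move=> hx; have /andP[x0 xM] := hx n.+1; have /andP[_ kkk] := kk_sub n.
by rewrite addr_ge0 ?mulr_ge0//= lerD2r; exact: ler_pM.
Qed.

(** By [M_inv] the worst case is (M + tau d M) / (1 + tau d) = M, without restriction on the size of
    tau. *)
Lemma euler_step_box tau x : 0 <= tau -> in_box x -> in_box (euler_step tau x).
Proof.
move=> tau0 hx n; have /andP[r0 rM] := rate_ge0 n hx.
have /andP[i0 iM] := inflow_le n kk_sub hx; have /andP[x0 xM] := hx n.
have D0 : 0 < 1 + tau * (kk n * x n.+1 + d n) by rewrite ltr_wpDr ?mulr_ge0.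
apply/andP; split; first by rewrite divr_ge0 ?(ltW D0)// addr_ge0// mulr_ge0.
rewrite ler_pdivrMr// mulrDr mulr1; apply: lerD => //.
rewrite mulrCA; apply: ler_wpM2l => //; apply: le_trans (iM) _; apply: le_trans (M_inv n) _.
by rewrite mulrC ler_wpM2l// lerDr mulr_ge0//; have /andP[] := hx n.+1.
Qed.

Lemma euler_stepE tau x n : 0 <= tau -> in_box x ->
  euler_step tau x n - x n = tau * rhs kk d x n / (1 + tau * (kk n * x n.+1 + d n)).
Proof.
move=> tau0 hx; have /andP[r0 rM] := rate_ge0 n hx.
have D0 : 1 + tau * (kk n * x n.+1 + d n) != 0.
  by rewrite gt_eqF// ltr_wpDr ?mulr_ge0.
by rewrite /euler_step /rhs; field.
Qed.

Lemma euler_step_le tau x n : 0 <= tau -> in_box x ->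
  `|euler_step tau x n - x n| <= tau * rhs_bound n /\
  `|euler_step tau x n - x n - tau * rhs kk d x n| <=
    tau ^+ 2 * (euler_rate n * rhs_bound n).
Proof.
move=> tau0 hx; rewrite euler_stepE//; have /andP[r0 rM] := rate_ge0 n hx.
have := rhs_norm_le d_ge0 n kk_sub hx.
move: (rhs kk d x n) => r rB; move: (kk n * x n.+1 + d n) r0 rM => c c0 cR.
have D0 : 0 < 1 + tau * c by rewrite ltr_wpDr ?mulr_ge0.
have D1 : (1 + tau * c)^-1 <= 1 by rewrite invf_le1// lerDl mulr_ge0.
have Di : 0 <= (1 + tau * c)^-1 by rewrite invr_ge0 ltW.
split.
  rewrite !normrM (ger0_norm tau0) (ger0_norm Di) -[X in _ <= X]mulr1.
  by apply: ler_pM => //; [apply: mulr_ge0 | apply: ler_wpM2l].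
have -> : tau * r / (1 + tau * c) - tau * r = - (tau ^+ 2 * (c * r) / (1 + tau * c)).
  by field; rewrite gt_eqF.
rewrite normrN !normrM (ger0_norm Di) (ger0_norm c0) ger0_norm ?sqr_ge0//.
rewrite -[X in _ <= X]mulr1; apply: ler_pM => //.
  by apply: mulr_ge0; [exact: sqr_ge0 | exact: mulr_ge0].
by apply: ler_wpM2l; [exact: sqr_ge0 | exact: ler_pM].
Qed.

Lemma iter_euler_box tau x i : 0 <= tau -> in_box x -> in_box (iter i (euler_step tau) x).
Proof. by move=> tau0 hx; elim: i => //= i; exact: euler_step_box. Qed.

Definition euler_error n := euler_rate n * rhs_bound n + rhs_lip rhs_bound n.

Let B_ge0 n : 0 <= rhs_bound n.
Proof.
have hM : in_box M by move=> m; rewrite M_ge0/=.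
exact: le_trans (rhs_norm_le d_ge0 n kk_sub hM).
Qed.

Let lip_ge0 n : 0 <= rhs_lip rhs_bound n.
Proof.
rewrite /rhs_lip addr_ge0 ?mulr_ge0// addr_ge0 ?mulr_ge0 ?addr_ge0 ?mulr_ge0//.
by case: (n) => // m; rewrite !mulr_ge0.
Qed.

Let rB_ge0 n : 0 <= euler_rate n * rhs_bound n.
Proof. by rewrite mulr_ge0// addr_ge0// mulr_ge0. Qed.

Lemma euler_error_ge0 n : 0 <= euler_error n.
Proof. exact: addr_ge0. Qed.

Lemma iter_euler_lip tau x i n : 0 <= tau -> in_box x ->
  `|iter i (euler_step tau) x n - x n| <= i%:R * tau * rhs_bound n.
Proof.
move=> tau0 hx; elim: i => [|i IHi]; first by rewrite /= subrr normr0 !mul0r.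
rewrite iterS -(subrK (iter i (euler_step tau) x n) (euler_step _ _ n)) -addrA.
apply: le_trans (ler_normD _ _) _; rewrite -[i.+1]add1n natrD mulrDl mul1r mulrDl.
apply: lerD => //.
by have [] := euler_step_le n tau0 (iter_euler_box i tau0 hx).
Qed.

(** Each step adds a consistency error of order tau^2 and the drift of [rhs] since the start, of
    order i tau^2. *)
Lemma iter_euler_le tau x i n : 0 <= tau -> in_box x ->
  `|iter i (euler_step tau) x n - x n - i%:R * tau * rhs kk d x n| <=
  euler_error n * ((i%:R * tau) ^+ 2 + i%:R * tau * tau).
Proof.
move=> tau0 hx; elim: i => [|i IHi].
  by rewrite /= subrr !mul0r subrr normr0 expr0n/= addr0 mulr0.
rewrite iterS; set y := iter i _ x in IHi *.
have hy : in_box y by exact: iter_euler_box.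
have [_ H1] := euler_step_le n tau0 hy.
have H2 : `|rhs kk d y n - rhs kk d x n| <= i%:R * tau * rhs_lip rhs_bound n.
  by apply: rhs_lip_le => // m; exact: iter_euler_lip.
have E : euler_step tau y n - x n - i.+1%:R * tau * rhs kk d x n =
  (y n - x n - i%:R * tau * rhs kk d x n) +
  ((euler_step tau y n - y n - tau * rhs kk d y n) + tau * (rhs kk d y n - rhs kk d x n)).
  by rewrite -natr1; ring.
rewrite E; apply: le_trans (ler_normD _ _) _.
apply: le_trans (lerD IHi (ler_normD _ _)) _.
apply: le_trans (lerD (lexx _) (lerD H1 (_ : _ <= tau * (i%:R * tau * rhs_lip rhs_bound n)))) _.
  by rewrite normrM (ger0_norm tau0) ler_wpM2l.
rewrite -natr1 -subr_ge0 /euler_error.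
have i0 : 0 <= i%:R :> R by [].
move: (i%:R) (euler_rate n * _) (rhs_lip _ n) i0 (rB_ge0 n) (lip_ge0 n) => j a b j0 a0 b0.
have -> : (a + b) * (((j + 1) * tau) ^+ 2 + (j + 1) * tau * tau) -
  ((a + b) * ((j * tau) ^+ 2 + j * tau * tau) + (tau ^+ 2 * a + tau * (j * tau * b))) =
  tau ^+ 2 * (a * (2 * j + 1) + b * (j + 2)) by ring.
apply: mulr_ge0; first exact: sqr_ge0.
by rewrite addr_ge0// mulr_ge0// addr_ge0// mulr_ge0.
Qed.

(** Piecewise constant in time with step 1 / (m + 1); regularity in time is recovered only in the
    limit. *)
Definition euler m h (t : R) : nat -> R :=
  iter (Num.truncn (t * m.+1%:R)) (euler_step m.+1%:R^-1) h.

(** The steps made between t and s account for s - t up to one time step. The last term pays for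
    this and vanishes as m grows. *)
Lemma euler_le h m n s t : in_box h -> 0 <= t -> t <= s ->
  `|euler m h s n - euler m h t n - (s - t) * rhs kk d (euler m h t) n| <=
  euler_error n * (s - t) ^+ 2 +
  m.+1%:R^-1 * (euler_error n * (3 * (s - t) + 2) + rhs_bound n).
Proof.
move=> hh t0 ts; set tau := m.+1%:R^-1; set de := s - t.
have m0 : 0 < m.+1%:R :> R by rewrite ltr0n.
have tau0 : 0 < tau by rewrite invr_gt0.
have tau1 : tau <= 1 by rewrite invf_le1// ler1n.
have de0 : 0 <= de by rewrite subr_ge0.
have mt0 : 0 <= t * m.+1%:R by rewrite mulr_ge0// ltW.
have ms0 : 0 <= s * m.+1%:R by rewrite mulr_ge0 ?(ltW m0)// (le_trans t0).
rewrite /euler -/tau; set a := Num.truncn (t * _); set b := Num.truncn (s * _).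
have /andP[aL aU] := truncn_itv mt0; have /andP[bL bU] := truncn_itv ms0.
rewrite -/a in aL aU; rewrite -/b in bL bU.
rewrite -[a.+1%:R]natr1 in aU; rewrite -[b.+1%:R]natr1 in bU.
have ab : (a <= b)%N.
  rewrite -ltnS -(ltr_nat R) -natr1; apply: le_lt_trans aL (le_lt_trans _ bU).
  by rewrite ler_wpM2r// ltW.
rewrite -(subnK ab) iterD; set x := iter a _ h.
have hx : in_box x by apply: iter_euler_box => //; exact: ltW.
have := iter_euler_le (b - a) n (ltW tau0) hx.
have siE : (b - a)%:R * tau = (b%:R - a%:R) * tau by rewrite natrB.
have : `|(b - a)%:R * tau - de| <= tau.
  rewrite siE -[X in _ <= X]mul1r.
  have -> : (b%:R - a%:R) * tau - de = (b%:R - a%:R - (s * m.+1%:R - t * m.+1%:R)) * tau.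
    by rewrite /de /tau; field; rewrite gt_eqF.
  rewrite normrM (gtr0_norm tau0) ler_wpM2r ?(ltW tau0)// ler_norml.
  by apply/andP; split; lra.
have : 0 <= (b - a)%:R * tau by rewrite mulr_ge0// ltW.
move: ((b - a)%:R * tau) => si si0 sid H.
have -> : iter (b - a) (euler_step tau) x n - x n - de * rhs kk d x n =
  (iter (b - a) (euler_step tau) x n - x n - si * rhs kk d x n) + (si - de) * rhs kk d x n.
  by ring.
apply: le_trans (ler_normD _ _) _; apply: le_trans (lerD H (lexx _)) _.
have Hr : `|(si - de) * rhs kk d x n| <= tau * rhs_bound n.
  by rewrite normrM; apply: ler_pM => //; exact: rhs_norm_le.
apply: le_trans (lerD (lexx _) Hr) _.
rewrite [tau * (_ + rhs_bound n)]mulrDr addrA lerD2r [tau * (_ * _)]mulrCA.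
rewrite -[X in _ <= X]mulrDr ler_wpM2l ?euler_error_ge0//.
have {}sid : si <= de + tau by move: sid; rewrite ler_norml => /andP[_]; lra.
apply: (@le_trans _ _ ((de + tau) ^+ 2 + (de + tau) * tau)).
  apply: lerD; last by rewrite ler_wpM2r// ltW.
  by rewrite lerXn2r// nnegrE// addr_ge0// ltW.
rewrite -subr_ge0.
have -> : de ^+ 2 + tau * (3 * de + 2) - ((de + tau) ^+ 2 + (de + tau) * tau) =
  2 * tau * (1 - tau) by ring.
by rewrite mulr_ge0 ?subr_ge0// mulr_ge0// ltW.
Qed.

Lemma exists_quadratic_solution h : in_box h ->
  exists u, quadratic_solution kk h euler_error u.
Proof.
move=> hh; have [|m t t0|m n|n s t e t0 ts e0|u hu _] :=
  @quadratic_limit kk h euler_error (fun m t => euler m h t); last by exists u.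
- exact: kk_sub.
- by apply: iter_euler_box => //; rewrite invr_ge0.
- by rewrite /euler mul0r truncn0.
have [N HN] := exists_nat_ge ((euler_error n * (3 * (s - t) + 2) + rhs_bound n) / e).
exists N => // m /= Nm; apply: le_trans (euler_le _ _ hh t0 ts) _; rewrite lerD2l.
rewrite ler_pdivrMl ?ltr0n// -ler_pdivrMr//; apply: le_trans HN _.
by rewrite ler_nat (leq_trans Nm).
Qed.
End Euler.
End Existence.

(** * Limit of the truncated systems *)

Section Galerkin.
Variables (R : realType) (k d h : nat -> R).
Hypotheses (k_ge0 : forall n, 0 <= k n) (d_gt0 : forall n, 0 < d n).
Hypothesis h_ge0 : nonneg_seq h.

(** A recursive supersolution: the larger of the datum and the equilibrium of the damping with the
    largest inflow from the shell below. It need not be bounded in n. *)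
Fixpoint box n : R :=
  if n is m.+1 then Num.max (h m.+1) (k m * box m ^+ 2 / d m.+1) else h 0%N.

Lemma box_ge n : 0 <= h n <= box n.
Proof. by rewrite h_ge0; case: n => [|n]; rewrite /= ?le_max lexx. Qed.

Lemma box_inv n : inflow k box n <= d n * box n.
Proof.
case: n => [|n] /=; first by rewrite mulr_ge0// ltW.
by rewrite [X in _ <= X]mulrC -ler_pdivrMr// le_max lexx orbT.
Qed.

Lemma truncate_subcoef K : subcoef k (truncate K k).
Proof. by move=> n; rewrite /truncate; case: ifP; rewrite k_ge0 lexx. Qed.

Lemma rhs_truncate K x n : (n < K)%N -> rhs (truncate K k) d x n = rhs k d x n.
Proof.
rewrite /rhs /inflow /truncate; case: n => [|n] nK; rewrite nK//.
by rewrite (ltnW nK).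
Qed.

(** At a given shell n the truncated and full equations agree once K > n. The second clause is the
    channel through which bounds uniform in the truncation reach the limit. *)
Lemma exists_shell_solution : exists2 u, shell_solution k d h +oo u &
  forall t n b, 0 <= t ->
    (forall K v, shell_solution (truncate K k) d h +oo v -> v t n <= b) -> u t n <= b.
Proof.
have d0 n : 0 <= d n by exact: ltW.
have box0 n : 0 <= box n by have /andP[x0 xM] := box_ge n; exact: le_trans x0 xM.
pose C := euler_error k d box.
have hk : subcoef k k by move=> n; rewrite k_ge0 lexx.
have C0 n : 0 <= C n by exact: (euler_error_ge0 k_ge0 d0 hk box0).
have /choice[w Hw] : forall K, exists u,
    quadratic_solution d box (truncate K k) h C u.
  move=> K; apply: exists_quadratic_solution => //.
  - exact: truncate_subcoef.
  - exact: box_inv.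
  - exact: box_ge.
have [||||u hu uB] := @quadratic_limit _ k d box k h C w.
- exact: hk.
- by move=> m t t0; have [H _ _] := Hw m; exact: H.
- by move=> m; have [_ _ H] := Hw m.
- move=> n s t e t0 ts e0; exists n.+1 => // K /= nK.
  have [_ H _] := Hw K; rewrite -(rhs_truncate _ nK).
  by apply: le_trans (H n s t t0 ts) _; rewrite lerDl ltW.
exists u; first exact: (quadratic_solution_shell k_ge0 d0 hk C0 hu).
move=> t n b t0 H; apply: uB => //; apply: nearW => K; apply: (H K).
exact: (quadratic_solution_shell k_ge0 d0 (@truncate_subcoef K) C0 (Hw K)).
Qed.
End Galerkin.

(** * Sobolev norms and energy inequality *)

Section Series.
Variable R : realType.

Lemma nneseries_le (a : nat -> R) C : (forall n, 0 <= a n) ->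
  (forall N, \sum_(i < N) a i <= C) -> (\sum_(0 <= n <oo) (a n)%:E <= C%:E)%E.
Proof.
move=> a0 H; apply: lime_le; first by apply: is_cvg_nneseries => n _ _; rewrite lee_fin.
by apply: nearW => N; rewrite big_mkord sumEFin lee_fin.
Qed.

Lemma partial_sum_le (a : nat -> R) N : (forall n, 0 <= a n) ->
  ((\sum_(i < N) a i)%:E <= \sum_(0 <= n <oo) (a n)%:E)%E.
Proof.
move=> a0; rewrite -sumEFin -(big_mkord xpredT (EFin \o a)).
by apply: nneseries_lim_ge => n _ _; rewrite lee_fin.
Qed.
End Series.

Section Sobolev.
Variables (R : realType) (N0 Lam : R).
Hypotheses (N0_gt0 : 0 < N0) (Lam_gt1 : 1 < Lam).
Implicit Types (x : nat -> R).

Let Lam_gt0 : 0 < Lam. Proof. exact: lt_trans Lam_gt1. Qed.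
Let Lam_ge0 : 0 <= Lam. Proof. exact: ltW. Qed.

Lemma freq_gt0 n : 0 < freq N0 Lam n.
Proof. by rewrite mulr_gt0// exprn_gt0. Qed.

Let Hterm_ge0 s x n : 0 <= freq N0 Lam n `^ (2 * s) * `|x n| ^+ 2.
Proof. by rewrite mulr_ge0 ?powR_ge0// sqr_ge0. Qed.

Lemma in_l2_le x C : (forall N, \sum_(i < N) x i ^+ 2 <= C) -> in_l2 x.
Proof.
move=> H; apply: le_lt_trans (ltry C); apply: nneseries_le => [n|N].
  exact: sqr_ge0.
by under eq_bigr do rewrite real_normK ?num_real//.
Qed.

(** The index p + 1 keeps the Sobolev exponent positive when p = 0. From X^2 <= S and (X - 1)^2 >= 0
    comes X <= 1 + S, without square roots. *)
Lemma Hnormsq_coord (p : nat) (S : R) : exists C, forall x n,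
  (Hnormsq N0 Lam p.+1%:R x <= S%:E)%E -> (Lam ^+ p) ^+ n * x n <= C.
Proof.
exists ((1 + S) / N0 ^+ p.+1) => x n H.
have x2 : (freq N0 Lam n ^+ p.+1 * `|x n|) ^+ 2 <= S.
  rewrite -lee_fin; apply: le_trans H.
  apply: le_trans (partial_sum_le n.+1 (Hterm_ge0 p.+1%:R x)).
  rewrite lee_fin exprMn -exprM mulnC -powR_mulrn; last exact/ltW/freq_gt0.
  by rewrite natrM; apply: (@ler_term_sum _ (fun n => freq N0 Lam n `^ (2 * p.+1%:R) * `|x n| ^+ 2)).
rewrite ler_pdivlMr ?exprn_gt0// mulrAC.
have cle : (Lam ^+ p) ^+ n * N0 ^+ p.+1 <= freq N0 Lam n ^+ p.+1.
  rewrite /freq exprMn mulrC ler_wpM2l ?exprn_ge0 ?(ltW N0_gt0)// -!exprM.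
  by apply: ler_weXn2l; [exact: ltW | rewrite mulnC leq_mul2l leqnSn orbT].
have c0 : 0 <= (Lam ^+ p) ^+ n * N0 ^+ p.+1 by rewrite mulr_ge0 ?exprn_ge0// ltW.
apply: (@le_trans _ _ (freq N0 Lam n ^+ p.+1 * `|x n|)).
  by apply: le_trans (ler_wpM2l c0 (ler_norm _)) _; rewrite ler_wpM2r.
have := sqr_ge0 (freq N0 Lam n ^+ p.+1 * `|x n| - 1); rewrite sqrrB1 -mulr_natr.
have : 0 <= freq N0 Lam n ^+ p.+1 * `|x n| by rewrite mulr_ge0// exprn_ge0// ltW// freq_gt0.
lra.
Qed.

(** The spare power of Lam^n leaves a geometric series of ratio Lam^-2. *)
Lemma Hnormsq_bound (s : R) (p : nat) C : s <= p%:R -> exists D : R, forall x,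
  (forall n, 0 <= x n /\ (Lam ^+ p.+1) ^+ n * x n <= C) -> (Hnormsq N0 Lam s x <= D%:E)%E.
Proof.
move=> sp; pose z := Lam^-1 ^+ 2.
have z01 : 0 <= z < 1.
  have Li : 0 <= Lam^-1 by rewrite invr_ge0.
  by rewrite /z sqr_ge0/= expr2 mulr_ilt1// invf_lt1.
exists (N0 `^ (2 * s) * C ^+ 2 * (1 - z)^-1) => x H.
have D0 : 0 <= N0 `^ (2 * s) * C ^+ 2 by rewrite mulr_ge0 ?powR_ge0// sqr_ge0.
apply: nneseries_le => [n|N]; first exact: Hterm_ge0.
apply: le_trans (ler_wpM2l D0 (sum_geometric_le N z01)).
rewrite mulr_sumr; apply: ler_sum => i _; have [x0 xC] := H i.
rewrite ger0_norm// /freq powRM ?exprn_ge0 ?(ltW N0_gt0)// -!mulrA.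
apply: ler_wpM2l; first exact: powR_ge0.
apply: (@le_trans _ _ ((Lam ^+ i) ^+ (2 * p) * x i ^+ 2)).
  apply: ler_wpM2r; first exact: sqr_ge0.
  rewrite -[_ ^+ (2 * p)]powR_mulrn ?exprn_ge0//; apply: ler_powR; first by rewrite exprn_ege1// ltW.
  by rewrite natrM ler_wpM2l.
have -> : (Lam ^+ i) ^+ (2 * p) * x i ^+ 2 = ((Lam ^+ p.+1) ^+ i * x i) ^+ 2 * z ^+ i.
  rewrite /z exprMn -!exprM exprVn [RHS]mulrAC; congr (_ * _).
  apply: (@mulIf _ (Lam ^+ (2 * i))); first by rewrite expf_neq0// gt_eqF.
  rewrite divfK ?expf_neq0 ?gt_eqF// -exprD; congr (_ ^+ _).
  by rewrite [(p.+1 * i)%N]mulSn mulnDl addnC [(2 * i)%N]mulnC [(2 * p)%N]mulnC mulnA [(i * p)%N]mulnC.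
rewrite [X in _ <= X]mulrA -expr2; apply: ler_wpM2r; first by rewrite exprn_ge0//; case/andP: z01.
have c0 : 0 <= (Lam ^+ p.+1) ^+ i * x i by rewrite mulr_ge0// !exprn_ge0.
by rewrite lerXn2r// nnegrE (le_trans c0).
Qed.

Lemma smooth_on_bound (u : R -> nat -> R) (a b : R) (p : nat) I : smooth_on N0 Lam I u ->
  `[a, b] `<=` I -> exists C, forall t n, a <= t <= b -> (Lam ^+ p) ^+ n * u t n <= C.
Proof.
move=> su abI; have := su a b abI p.+1%:R ltac:(by rewrite ltr0n).
set S := ereal_sup _ => Soo; have [C HC] := Hnormsq_coord p (fine S).
exists C => t n tab; apply: HC.
have tS : (Hnormsq N0 Lam p.+1%:R (u t) <= S)%E.
  by apply: ereal_sup_ubound; exists t => //=; rewrite in_itv.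
rewrite fineK// fin_real// Soo andbT; apply: lt_le_trans tS.
by apply: lt_le_trans (nneseries_ge0 _) => // n0 _ _; rewrite lee_fin Hterm_ge0.
Qed.

Lemma bound_smooth_on (u : R -> nat -> R) T :
  nonneg_on (times T) u ->
  (forall p t, times T t -> exists C, forall r n, 0 <= r <= t -> (Lam ^+ p) ^+ n * u r n <= C) ->
  smooth_on N0 Lam (times T) u.
Proof.
move=> u0 H a b abT s s0; have [ab|ba] := leP a b; last first.
  rewrite set_itv_ge ?image_set0 ?ereal_sup0 ?ltNyr// -leNgt.
  by rewrite bnd_simp.
have Tb : times T b by apply: abT; rewrite /= in_itv/= ab lexx.
have Ta : times T a by apply: abT; rewrite /= in_itv/= ab lexx.
have [p sp] := exists_nat_ge s; have [C HC] := H p.+1 b Tb.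
have [D HD] := Hnormsq_bound C sp.
apply: le_lt_trans (ltry D); apply: ge_ereal_sup => _ [t /= tab <-].
apply: HD => n; split; first by apply: u0; apply: abT.
apply: HC; move: tab; rewrite in_itv/= => /andP[a_t ->]; rewrite andbT.
by have [a0 _] := Ta; exact: le_trans a_t.
Qed.

Lemma in_Hinf_rapid h : in_Hinf N0 Lam h -> rapid Lam h.
Proof.
move=> hh p; have Soo := hh p.+1%:R ltac:(by rewrite ltr0n).
have [C HC] := Hnormsq_coord p (fine (Hnormsq N0 Lam p.+1%:R h)).
exists C => n; apply: HC; rewrite fineK// fin_real// Soo andbT.
by apply: lt_le_trans (nneseries_ge0 _) => // m _ _; rewrite lee_fin Hterm_ge0.
Qed.
End Sobolev.

(** * Uniqueness and the energy inequality *)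

Section Energy.
Variables (R : realType) (N0 nu Lam alpha : R).
Hypotheses (N0_gt0 : 0 < N0) (nu_gt0 : 0 < nu) (Lam_gt1 : 1 < Lam).
Implicit Types (h : nat -> R) (u v : R -> nat -> R) (T : \bar R).

Definition viscosity n : R := nu * freq N0 Lam n `^ (2 * alpha).

Local Notation k := (freq N0 Lam).
Local Notation d := viscosity.

Lemma freq_ge0 n : 0 <= k n.
Proof. exact/ltW/freq_gt0. Qed.

Lemma viscosity_gt0 n : 0 < d n.
Proof. by rewrite mulr_gt0// powR_gt0// freq_gt0. Qed.

Lemma viscosity_ge0 n : 0 <= d n.
Proof. exact/ltW/viscosity_gt0. Qed.

Lemma finite_energy_shell h T u : (0 < T)%E ->
  finite_energy_solution N0 Lam nu alpha h (times T) u -> nonneg_on (times T) u ->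
  shell_solution k d h T u.
Proof.
move=> T0 [_ _ du u0] un; by split=> // n; apply: u0; split.
Qed.

(** Only the continuity of the right-hand side is drawn from this: it makes the coordinates C^1 and
    allows integration of their derivatives. *)
Lemma dw_rhs h T u n t : shell_solution k d h T u -> times T t ->
  exists l, is_derive_within (times T) (fun s => rhs k d (u s) n) t l.
Proof.
move=> [_ du _] Tt; have D m := du m t Tt.
have [li Hi] : exists l, is_derive_within (times T) (fun s => inflow k (u s) n) t l.
  case: (n) => [|m] /=; first by exists 0; exact: dw_cst.
  by eexists; apply: dw_scale; apply: dw_mul; exact: D.
eexists; apply: dw_add; first apply: dw_add.
- exact: Hi.
- by apply: dw_opp; apply: dw_mul (D n.+1); apply: dw_scale; exact: D.
- by apply: dw_opp; apply: dw_scale; exact: D.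
Qed.

Lemma shell_finite_energy h T u C : (0 < T)%E ->
  (forall N, \sum_(i < N) h i ^+ 2 <= C) ->
  shell_solution k d h T u -> finite_energy_solution N0 Lam nu alpha h (times T) u.
Proof.
move=> T0 hC hu; have [u0 du uh] := hu; split=> // [t Tt|n].
  apply: (@in_l2_le _ _ C) => N; have [t0 _] := Tt.
  apply: le_trans (energy_le N freq_ge0 viscosity_ge0 hu (lexx 0) t0 Tt) _.
  by under eq_bigr do rewrite uh.
exists (fun t => rhs k d (u t) n); first by move=> t; exact: du.
by apply: dw_continuous => t Tt; exact: dw_rhs hu Tt.
Qed.

(** Weak-strong uniqueness: [v] is controlled by its energy alone, and each mixed boundary term
    contains k_N u_N or k_N u_(N+1), both at most N0 C. *)
Lemma solution_unique h T u v t C S :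
  (forall N, \sum_(i < N) h i ^+ 2 <= S) ->
  shell_solution k d h T u -> shell_solution k d h T v -> times T t ->
  (forall r n, 0 <= r <= t -> Lam ^+ n * u r n <= C) -> forall n, v t n = u t n.
Proof.
move=> hS hu hv Tt HC; have [u0 _ _] := hu; have [v0 _ vh] := hv; have [t0 _] := Tt.
have S0 : 0 <= S by have := hS 0%N; rewrite big_ord0.
have L0 n : 0 <= Lam ^+ n by rewrite exprn_ge0// (le_trans ler01)// ltW.
have L1 n : 1 <= Lam ^+ n by rewrite exprn_ege1// ltW.
have tl : 0 <= (0 : R) <= t by rewrite t0 lexx.
have C0 : 0 <= C.
  apply: le_trans (HC 0 0%N tl); rewrite mulr_ge0//; apply: u0; split=> //.
  by apply: le_lt_trans (proj2 Tt); rewrite lee_fin.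
have Tr r : 0 <= r <= t -> times T r.
  by move=> /andP[r0 rt]; apply: (times_segment (lexx 0) Tt); rewrite /= in_itv/= r0.
have vS r n : 0 <= r <= t -> v r n ^+ 2 <= S.
  move=> rt; have /andP[r0 _] := rt.
  apply: le_trans (_ : \sum_(i < n.+1) v r i ^+ 2 <= _).
    by apply: (@ler_term_sum _ (fun i => v r i ^+ 2)) => // i; exact: sqr_ge0.
  apply: le_trans (energy_le _ freq_ge0 viscosity_ge0 hv (lexx 0) r0 (Tr r rt)) _.
  by under eq_bigr do rewrite vh.
apply: (@shell_solution_unique _ k d h T u v t (S * (N0 * C) + N0 * C * C * (1 + S))
  freq_ge0 viscosity_ge0 hu hv Tt).
move=> N r rt; have un n := u0 r (Tr r rt) n; have vn n := v0 r (Tr r rt) n.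
have ku1 : k N * u r N.+1 <= N0 * C.
  rewrite /freq -mulrA ler_wpM2l ?(ltW N0_gt0)//; apply: le_trans (HC r N.+1 rt).
  by rewrite ler_wpM2r// ler_weXn2l// ltW.
have ku : k N * u r N <= N0 * C.
  by rewrite /freq -mulrA ler_wpM2l ?(ltW N0_gt0)//; exact: HC.
have uC : u r N <= C by apply: le_trans (HC r N rt); rewrite ler_peMl.
have v1 : v r N.+1 <= 1 + S.
  have := vS r N.+1 rt; have := sqr_ge0 (v r N.+1 - 1); rewrite sqrrB1 -mulr_natr.
  have := vn N.+1; lra.
rewrite mulrDr; apply: lerD.
  by rewrite mulrCA; apply: ler_pM => //; [exact: sqr_ge0 | exact: mulr_ge0 (freq_ge0 _) _ | exact: vS].
rewrite expr2 !mulrA; apply: ler_pM => //.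
  by apply: mulr_ge0 => //; exact: mulr_ge0 (freq_ge0 _) _.
by apply: ler_pM => //; exact: mulr_ge0 (freq_ge0 _) _.
Qed.

Lemma dissipation_integral_le h T u N a b : shell_solution k d h T u ->
  0 <= a -> a < b -> times T b ->
  (\int[lebesgue_measure]_(t in `[a, b]) (\sum_(i < N) 2 * (d i * u t i ^+ 2))%:E <=
   (\sum_(i < N) u a i ^+ 2 - \sum_(i < N) u b i ^+ 2)%:E)%E.
Proof.
move=> hu a0 ab Tb; have [u0 du _] := hu; have sub := times_segment a0 Tb.
(* Minus the partial energy: its derivative dominates the non-negative dissipation, so integrals of
   non-negative functions can be compared. *)
pose F (t : R) : R := \sum_(i < N) (-1) * u t i ^+ 2.
pose f (t : R) : R := 2 * \sum_(i < N) (-1) * (u t i * rhs k d (u t) i).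
have dF t : times T t -> is_derive_within (times T) F t (f t).
  by move=> Tt; apply: (@dw_sqr_sum _ T u (fun t => rhs k d (u t)) (fun=> -1)) => n; exact: du.
have dG t : times T t -> exists l,
    is_derive_within (times T) (fun t => \sum_(i < N) 2 * (d i * u t i ^+ 2)) t l.
  move=> Tt; eexists; apply: (@dw_sum _ _ (fun i t => 2 * (d i * u t i ^+ 2))) => i _.
  by apply: dw_scale; apply: dw_scale; apply: dw_mul; exact: du.
have df t : times T t -> exists l, is_derive_within (times T) f t l.
  move=> Tt; have /choice[l Hl] n := dw_rhs n hu Tt.
  eexists; apply: dw_scale; apply: (@dw_sum _ _ (fun i t => -1 * (u t i * rhs k d (u t) i))) => i _.
  by apply: dw_scale; apply: dw_mul (Hl i); exact: du.
have cont g : (forall t, times T t -> exists l, is_derive_within (times T) g t l) ->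
    {within `[a, b], continuous g}.
  move=> Hg; apply: dw_continuous => t abt; have [l Hl] := Hg t (sub t abt).
  by exists l; exact: dw_sub Hl.
have cf := cont _ df; have cG := cont _ dG.
have cF : {within `[a, b], continuous F} by apply: cont => t Tt; exists (f t); exact: dF.
have D c : c \in `]a, b[%R -> is_derive c 1 F (f c).
  move=> cab; apply: (@is_derive_dw _ (times T)).
    near=> s; apply/sub/subset_itv_oo_cc; near: s; exact: near_in_itvoo.
  by apply/dF/sub/subset_itv_oo_cc.
have mE (g : R -> R) : {within `[a, b], continuous g} -> measurable_fun `[a, b] (EFin \o g).
  by move=> cg; apply/measurable_EFinP; apply: subspace_continuous_measurable_fun.
have -> : (\sum_(i < N) u a i ^+ 2 - \sum_(i < N) u b i ^+ 2) = F b - F a.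
  by rewrite /F -!mulr_sumr; ring.
have [_ Fa Fb] := (continuous_within_itvP F ab).1 cF.
rewrite EFinB -(continuous_FTC2 ab cf) => [|| c cab].
- apply: ge0_le_integral => //; [|exact: mE|exact: mE|].
    move=> t _; rewrite lee_fin sumr_ge0// => i _.
    by rewrite mulr_ge0// mulr_ge0 ?sqr_ge0// viscosity_ge0.
  move=> t abt; rewrite lee_fin /f -!mulr_sumr.
  have := energy_derive_le N freq_ge0 hu (sub t abt).
  under eq_bigr do rewrite mul1r.
  lra.
- by split => // c cab; have [] := D c cab.
- by have := D c cab; rewrite derive1E => /@derive_val.
Unshelve. all: by end_near.
Qed.

(** Exchanging integral and series of non-negative terms makes the left side a limit over N of
    N-shell quantities, each bounded by the N-shell energy at [t0]. *)
Lemma shell_energy_ineq h T u t0 t : shell_solution k d h T u ->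
  0 <= t0 -> t0 <= t -> times T t -> energy_ineq N0 Lam nu alpha u t0 t.
Proof.
move=> hu t00 tt Tt; have [u0 du _] := hu; have sub := times_segment t00 Tt.
rewrite /energy_ineq.
pose g n s : R := freq N0 Lam n `^ (2 * alpha) * `|u s n| ^+ 2.
have g0 n s : 0 <= g n s by rewrite mulr_ge0 ?powR_ge0// sqr_ge0.
have mg n : measurable_fun `[t0, t] (g n).
  apply: subspace_continuous_measurable_fun => //.
  apply: dw_continuous => s /sub Ts; eexists; apply: dw_sub sub _.
  have E r : times T r -> k n `^ (2 * alpha) * u r n ^+ 2 = g n r.
    by move=> Tr; rewrite /g ger0_norm//; exact: u0.
  apply: dw_ext E (E s Ts) _; apply: dw_scale; apply: dw_mul; exact: du.
rewrite [X in ((2 * nu)%:E * X)%E](_ : _ =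
  \sum_(0 <= n <oo) \int[lebesgue_measure]_(s in `[t0, t]) (g n s)%:E)%E; last first.
  rewrite -integral_nneseries// => n.
    by apply/measurable_EFinP; exact: mg.
  by move=> s _; rewrite lee_fin.
rewrite -nneseriesZl => [|n _]; last by apply: integral_ge0 => s _; rewrite lee_fin.
have i0 n : (0 <= (2 * nu)%:E * \int[lebesgue_measure]_(s in `[t0, t]) (g n s)%:E)%E.
  apply: mule_ge0; first by rewrite lee_fin mulr_ge0// ltW.
  by apply: integral_ge0 => s _; rewrite lee_fin.
have l0 (s : R) n : (0 <= (`|u s n| ^+ 2)%:E)%E by rewrite lee_fin sqr_ge0.
rewrite /l2normsq -nneseriesD//.
apply: lime_le.
  by apply: is_cvg_nneseries => n _ _; rewrite adde_ge0.
apply: nearW => N; rewrite big_mkord.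
apply: le_trans (partial_sum_le N (fun n => sqr_ge0 `|u t0 n|)).
rewrite big_split/=.
have sE s : (\sum_(i < N) (`|u s i| ^+ 2)%:E = (\sum_(i < N) `|u s i| ^+ 2)%:E)%E.
  by rewrite sumEFin.
(* The fundamental theorem behind [dissipation_integral_le] needs a non-degenerate interval. *)
rewrite sE; have [tE|ttn] := eqVneq t0 t.
  by rewrite tE [X in (_ + X)%E]big1 ?adde0// => i _; rewrite set_itv1 integral_set1 mule0.
have lt_t : t0 < t by rewrite lt_neqAle ttn.
have := dissipation_integral_le N hu t00 lt_t Tt.
set I := integral _ _ _.
have -> : I = (\sum_(i < N) (2 * nu)%:E * \int[lebesgue_measure]_(s in `[t0, t]) (g i s)%:E)%E.
  rewrite /I; under eq_integral => s st.
    have -> : \sum_(i < N) 2 * (d i * u s i ^+ 2) = \sum_(i < N) (2 * nu) * g i s.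
      apply: eq_bigr => i _; rewrite /g /viscosity real_normK ?num_real//; ring.
    rewrite -sumEFin.
  over.
  rewrite ge0_integral_sum//; last 2 first.
  - move=> i; apply/measurable_EFinP; apply: measurable_funM => //.
    exact: mg.
  - by move=> i s _; rewrite lee_fin; apply: mulr_ge0 (g0 _ _); rewrite mulr_ge0// ltW.
  have nu2 : (0 <= (2 * nu)%:E)%E by rewrite lee_fin mulr_ge0// ltW.
  apply: eq_bigr => i _; have mgE : measurable_fun `[t0, t] (fun s => (g i s)%:E).
    by apply/measurable_EFinP; exact: mg.
  have gE0 s : `[t0, t]%classic s -> (0 <= (g i s)%:E)%E.
    by move=> _; rewrite lee_fin; exact: g0.
  exact: (ge0_integralZl lebesgue_measure (measurable_itv _) mgE gE0 nu2).
have nE s : \sum_(i < N) `|u s i| ^+ 2 = \sum_(i < N) u s i ^+ 2.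
  by apply: eq_bigr => i _; rewrite real_normK ?num_real.
rewrite !nE => H; apply: le_trans (leeD (lexx _) H) _.
by rewrite -EFinD lee_fin addrC subrK.
Qed.
End Energy.

(** * Blow-up below the critical exponent *)

Section BlowUp.
Variable R : realType.

(** While g >= A, half of c g^2 absorbs C, so 1/g falls at rate at least c/2 from 1/A and would
    reach 0 at time 2 / (c A). *)
Lemma riccati_blowup T (g g' : R -> R) (A c C : R) : 0 < c -> 0 < A -> 2 * C <= c * A ^+ 2 ->
  times T (2 / (c * A)) ->
  (forall t, times T t -> is_derive_within (times T) g t (g' t)) ->
  (forall t, 0 <= t <= 2 / (c * A) -> c * g t ^+ 2 - C <= g' t) ->
  g 0 = A -> False.
Proof.
move=> c0 A0 CA; set T1 := 2 / (c * A) => TT1 dg Hg g0; have [T10 _] := TT1.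
have Tt t : 0 <= t <= T1 -> times T t.
  by move=> /andP[t0 tT]; apply: (times_segment (lexx 0) TT1); rewrite /= in_itv/= t0.
have cA : 0 < c * A by rewrite mulr_gt0.
have gA t : 0 <= t <= T1 -> A <= g t.
  (* The tangent of c g^2 at A gives (g - A)' >= 2 c A (g - A), and [expR (D * t)] is its
     integrating factor. *)
  move=> /andP[t0 tT]; pose D := - (2 * (c * A)).
  have : expR (D * t) * (A - g t) <= expR (D * 0) * (A - g 0) + 0 * (t - 0).
    apply: (@dw_times_le _ T (fun s => expR (D * s) * (A - g s))
      (fun s => D * expR (D * s) * (A - g s) + expR (D * s) * (0 - g' s))) => //.
    - by apply: Tt; rewrite t0.
    - move=> s Ts; apply: dw_mul; first exact: dw_expR.
      by apply: dw_add; [exact: dw_cst | apply: dw_opp; exact: dg].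
    move=> s /andP[s0 st].
    have -> : D * expR (D * s) * (A - g s) + expR (D * s) * (0 - g' s) =
      expR (D * s) * (2 * (c * A) * (g s - A) - g' s) by rewrite /D; ring.
    rewrite mulr_ge0_le0 ?expR_ge0// subr_le0; apply: le_trans (Hg s _); last first.
      by rewrite s0 (le_trans st).
    have : 0 <= c * (g s - A) ^+ 2 by rewrite mulr_ge0 ?sqr_ge0// ltW.
    have : 0 <= c * A ^+ 2 by rewrite mulr_ge0 ?sqr_ge0// ltW.
    lra.
  by rewrite mul0r addr0 g0 subrr mulr0 pmulr_rle0 ?expR_gt0// subr_le0.
have : (g T1)^-1 <= (g 0)^-1 + - (c / 2) * (T1 - 0).
  have gpos t : 0 <= t <= T1 -> 0 < g t by move=> /gA; exact: lt_le_trans.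
  apply: (@dw_le _ `[0, T1] (fun t => (g t)^-1) (fun t => - g' t / g t ^+ 2)) => // t tT.
    apply: dw_inv; first by rewrite gt_eqF// gpos.
    by apply: dw_sub (dg t (Tt t tT)); exact: times_segment TT1.
  rewrite mulNr lerNl opprK ler_pdivlMr ?exprn_gt0 ?gpos//.
  apply: le_trans (Hg t tT); have := gA t tT => gAt.
  have : c * A ^+ 2 <= c * g t ^+ 2.
    by rewrite ler_pM2l// lerXn2r// nnegrE; [exact: ltW | exact/ltW/gpos].
  lra.
rewrite subr0 g0 (_ : - (c / 2) * T1 = - A^-1); last by rewrite /T1; field; rewrite !gt_eqF.
rewrite subrr invr_le0 leNgt; apply/negP; rewrite negbK.
by apply: lt_le_trans A0 (gA T1 _); rewrite lexx andbT.
Qed.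

(** * Quadratic growth of the weighted sum *)

Section WeightedSum.
Variables (N0 Lam d0 q theta sigma : R).
Hypotheses (N0_gt0 : 0 < N0) (Lam_gt1 : 1 < Lam).
Hypotheses (theta_gt0 : 0 < theta) (sigma_gt0 : 0 < sigma).
Hypotheses (sigma2 : theta * Lam = sigma ^+ 2) (theta_sigma : 1 < theta * sigma).
Hypotheses (thetaq : theta * q ^+ 2 < Lam) (theta_lt : theta < Lam).

Local Notation k := (freq N0 Lam).
Local Notation d := (fun n => d0 * q ^+ n).

Let Lam_gt0 : 0 < Lam. Proof. exact: lt_trans Lam_gt1. Qed.
Let k_gt0 n : 0 < k n. Proof. exact: freq_gt0. Qed.
Let th_gt0 n : 0 < theta ^+ n. Proof. exact: exprn_gt0. Qed.

(** In units of a_n = theta^n k_n u_n^2, inflow gains theta and outflow costs at most 1/sigma. Half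
    of the margin pays for the damping, up to the remainder [kappa * z ^+ n]; the half that is left
    is [delta]. *)
Let delta := (theta - sigma^-1) / 2.
Let z := theta * q ^+ 2 / Lam.
Let kappa := d0 ^+ 2 / (4 * delta * N0).

Let sigmaV : sigma^-1 < theta. Proof. by rewrite -div1r ltr_pdivrMr. Qed.
Let delta_gt0 : 0 < delta. Proof. by rewrite divr_gt0// subr_gt0. Qed.
Let z_itv : 0 <= z < 1.
Proof.
apply/andP; split; last by rewrite ltr_pdivrMr// mul1r.
by apply: divr_ge0 (ltW Lam_gt0); apply: mulr_ge0 (sqr_ge0 _); exact: ltW.
Qed.
Let kappa_ge0 : 0 <= kappa.
Proof.
apply: divr_ge0 (sqr_ge0 _) (mulr_ge0 (mulr_ge0 (ler0n _ 4) (ltW delta_gt0)) (ltW N0_gt0)).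
Qed.

Variable u : nat -> R.

Let a n := theta ^+ n * k n * u n ^+ 2.

(** AM-GM for u_n and sigma u_(n+1), where sigma^2 = theta Lam is the ratio of consecutive weights
    in [a]. *)
Let transfer_le n : theta ^+ n * (k n * u n * u n.+1) <= sigma^-1 / 2 * (a n + a n.+1).
Proof.
have -> : a n.+1 = theta ^+ n * k n * (sigma * u n.+1) ^+ 2.
  by rewrite /a /freq [theta ^+ n.+1]exprS [Lam ^+ n.+1]exprS exprMn -sigma2; ring.
rewrite -subr_ge0 /a.
have -> : sigma^-1 / 2 * (theta ^+ n * k n * u n ^+ 2 + theta ^+ n * k n * (sigma * u n.+1) ^+ 2) -
   theta ^+ n * (k n * u n * u n.+1) =
   theta ^+ n * k n * (sigma^-1 / 2) * (u n - sigma * u n.+1) ^+ 2.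
  by field; rewrite gt_eqF.
apply: mulr_ge0 (sqr_ge0 _); apply: mulr_ge0.
  by apply: mulr_ge0; exact: ltW.
by rewrite divr_ge0// invr_ge0 ltW.
Qed.

Let damping_le n : theta ^+ n * (d n * u n) <= delta * a n + kappa * z ^+ n.
Proof.
rewrite -subr_ge0 /a /kappa /z 2!exprMn exprVn -exprM mulnC exprM /freq.
have Ln : 0 < Lam ^+ n by exact: exprn_gt0.
have -> : delta * (theta ^+ n * (N0 * Lam ^+ n) * u n ^+ 2) +
  d0 ^+ 2 / (4 * delta * N0) * (theta ^+ n * (q ^+ n) ^+ 2 / Lam ^+ n) -
  theta ^+ n * (d0 * q ^+ n * u n) =
  theta ^+ n / (4 * delta * N0 * Lam ^+ n) *
    (2 * delta * N0 * Lam ^+ n * u n - d0 * q ^+ n) ^+ 2.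
  by field; rewrite !gt_eqF.
apply: mulr_ge0 (sqr_ge0 _); apply: divr_ge0; first exact: ltW.
exact: mulr_ge0 (mulr_ge0 (mulr_ge0 (ler0n _ 4) (ltW delta_gt0)) (ltW N0_gt0)) (ltW Ln).
Qed.

(** The bracket is the loss from stopping at N: the inflow into shell N + 1, and the share of
    a_(N+1) in the last transfer. *)
Lemma sum_weighted_rhs_ge N :
  delta * \sum_(n < N.+1) a n - kappa * \sum_(n < N.+1) z ^+ n -
    (theta * a N + sigma^-1 / 2 * a N.+1) <=
  \sum_(n < N.+1) theta ^+ n * rhs k d u n.
Proof.
have a0 n : 0 <= a n by rewrite mulr_ge0 ?sqr_ge0// mulr_ge0// ltW.
have s0 : 0 <= sigma^-1 * a 0 by rewrite mulr_ge0// invr_ge0 ltW.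
have dE : delta = theta - sigma^-1 - delta by rewrite /delta; field; rewrite gt_eqF.
elim: N => [|N IHN].
  rewrite !big_ord_recr !big_ord0 /rhs/= !add0r; have := transfer_le 0; have := damping_le 0.
  have : delta * a 0 = (theta - sigma^-1 - delta) * a 0 by rewrite -dE.
  rewrite expr0; lra.
rewrite big_ord_recr [X in _ - _ * X]big_ord_recr [X in _ <= X]big_ord_recr/=.
have -> : theta ^+ N.+1 * rhs k d u N.+1 =
  theta * a N - theta ^+ N.+1 * (k N.+1 * u N.+1 * u N.+2) - theta ^+ N.+1 * (d N.+1 * u N.+1).
  by rewrite /rhs /inflow /a exprS; ring.
have := transfer_le N.+1; have := damping_le N.+1.
have : delta * a N.+1 = (theta - sigma^-1 - delta) * a N.+1 by rewrite -dE.
lra.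
Qed.

Let S2 := (N0 * (1 - theta / Lam))^-1.

Let S2_gt0 : 0 < S2.
Proof. by rewrite invr_gt0 mulr_gt0// subr_gt0 ltr_pdivrMr// mul1r. Qed.

(** Cauchy-Schwarz against sum theta^n / k_n <= S2, obtained from the non-negative sum of theta^n
    (k_n u_n - m)^2 / k_n with m = g / S2. *)
Lemma sqr_weighted_sum_le N : (\sum_(n < N) theta ^+ n * u n) ^+ 2 / S2 <= \sum_(n < N) a n.
Proof.
set g := \sum_(n < N) _; pose m := g / S2.
have H : 0 <= \sum_(n < N) (a n - 2 * m * (theta ^+ n * u n) + m ^+ 2 / N0 * (theta / Lam) ^+ n).
  apply: sumr_ge0 => i _; rewrite [(theta / Lam) ^+ i]exprMn exprVn /a /freq.
  have Ln : 0 < Lam ^+ i by exact: exprn_gt0.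
  have -> : theta ^+ i * (N0 * Lam ^+ i) * u i ^+ 2 - 2 * m * (theta ^+ i * u i) +
    m ^+ 2 / N0 * (theta ^+ i / Lam ^+ i) =
    theta ^+ i / (N0 * Lam ^+ i) * (N0 * Lam ^+ i * u i - m) ^+ 2.
    by field; rewrite !gt_eqF.
  by apply: mulr_ge0 (sqr_ge0 _); rewrite divr_ge0// ?mulr_ge0// ltW.
move: H; rewrite big_split sumrB/= -!mulr_sumr -/g.
have : m ^+ 2 / N0 * (\sum_(n < N) (theta / Lam) ^+ n) <= m ^+ 2 * S2.
  rewrite -mulrA ler_wpM2l ?sqr_ge0// /S2 invfM ler_wpM2l ?invr_ge0 ?(ltW N0_gt0)//.
  by apply: sum_geometric_le; rewrite ltr_pdivrMr// mul1r theta_lt andbT divr_ge0 ?ltW.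
have -> : m ^+ 2 * S2 = g ^+ 2 / S2 by rewrite /m; field; rewrite gt_eqF.
have -> : 2 * m * g = 2 * (g ^+ 2 / S2) by rewrite /m; field; rewrite gt_eqF.
lra.
Qed.

Lemma weighted_rhs_ge N :
  delta / S2 * (\sum_(n < N.+1) theta ^+ n * u n) ^+ 2 - kappa / (1 - z) -
    (theta * a N + sigma^-1 / 2 * a N.+1) <=
  \sum_(n < N.+1) theta ^+ n * rhs k d u n.
Proof.
apply: le_trans (sum_weighted_rhs_ge N).
rewrite lerD2r lerB//; last by rewrite ler_wpM2l// sum_geometric_le.
by rewrite mulrAC -mulrA ler_pM2l// sqr_weighted_sum_le.
Qed.
End WeightedSum.

Section Supercritical.
Variables (N0 Lam d0 q theta sigma : R).
Hypotheses (N0_gt0 : 0 < N0) (Lam_gt1 : 1 < Lam).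
Hypotheses (theta_gt0 : 0 < theta) (sigma_gt0 : 0 < sigma).
Hypotheses (sigma2 : theta * Lam = sigma ^+ 2) (theta_sigma : 1 < theta * sigma).
Hypotheses (thetaq : theta * q ^+ 2 < Lam) (theta_lt : theta < Lam).

Local Notation k := (freq N0 Lam).
Local Notation d := (fun n => d0 * q ^+ n).

Lemma rapid_blowup : exists (A T1 : R), [/\ 0 < A, 0 < T1 &
  forall T h v, (forall n, h n = if n is 0 then A else 0) ->
  shell_solution k d h T v -> times T T1 ->
  (exists C, forall t n, 0 <= t <= T1 -> (Lam ^+ 2) ^+ n * v t n <= C) -> False].
Proof.
have L0 : 0 < Lam by exact: lt_trans Lam_gt1.
pose c := (theta - sigma^-1) / 2 / (N0 * (1 - theta / Lam))^-1.
pose C1 := d0 ^+ 2 / (4 * ((theta - sigma^-1) / 2) * N0) / (1 - theta * q ^+ 2 / Lam).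
have sV : sigma^-1 < theta by rewrite -div1r ltr_pdivrMr.
have c0 : 0 < c.
  by rewrite divr_gt0// ?divr_gt0 ?subr_gt0// invr_gt0 mulr_gt0// subr_gt0 ltr_pdivrMr// mul1r.
have C10 : 0 <= C1.
  apply: divr_ge0; last by rewrite subr_ge0 ltW// ltr_pdivrMr// mul1r.
  by rewrite divr_ge0 ?sqr_ge0// !mulr_ge0 ?invr_ge0// ?subr_ge0// ltW.
(* The 1 added to [C1] absorbs the boundary terms of the weighted sum. The [N] that makes them so
   small depends on the solution, while [A] and the blow-up time do not. *)
pose A := 1 + 2 * (C1 + 1) / c.
have A1 : 1 <= A by rewrite /A lerDl; apply: divr_ge0 (ltW c0); apply: mulr_ge0 => //; exact: addr_ge0.
have A0 : 0 < A by exact: lt_le_trans A1.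
have CA : 2 * (C1 + 1) <= c * A ^+ 2.
  apply: (@le_trans _ _ (c * A)).
    have -> : c * A = c + 2 * (C1 + 1) by rewrite /A; field; rewrite gt_eqF.
    by rewrite lerDr ltW.
  by rewrite ler_pM2l// expr2 ler_peMl// ltW.
exists A, (2 / (c * A)); split=> //; first by apply: divr_gt0 => //; exact: mulr_gt0.
move=> T h v hE hv TT1 [C HC]; have [v0 dv vh] := hv; set T1 := 2 / (c * A) in TT1 HC.
have Tt t : 0 <= t <= T1 -> times T t.
  by move=> /andP[t0 tT]; apply: (times_segment (lexx 0) TT1); rewrite /= in_itv/= t0.
have Cp : 0 <= C.
  have [T10 _] := TT1; have z01 : 0 <= (0 : R) <= T1 by rewrite lexx.
  by apply: le_trans (HC 0 0%N z01); rewrite expr0 mul1r; exact: v0 (Tt _ z01) _.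
have aC t n : 0 <= t <= T1 -> theta ^+ n * k n * v t n ^+ 2 <= N0 * C ^+ 2 / Lam ^+ n.
  move=> tT; have vtn := v0 t (Tt t tT) n; rewrite ler_pdivlMr ?exprn_gt0// /freq.
  have Ln : 1 <= Lam ^+ n by rewrite exprn_ege1// ltW.
  apply: (@le_trans _ _ (N0 * ((Lam ^+ 2) ^+ n * v t n) ^+ 2)); last first.
    rewrite ler_pM2l// lerXn2r ?nnegrE//; last exact: HC.
    by rewrite mulr_ge0// !exprn_ge0// ltW.
  have -> : (Lam ^+ 2) ^+ n = Lam ^+ n * Lam ^+ n by rewrite -exprM mul2n -addnn exprD.
  have -> : theta ^+ n * (N0 * Lam ^+ n) * v t n ^+ 2 * Lam ^+ n =
    theta ^+ n * (N0 * Lam ^+ n ^+ 2 * v t n ^+ 2) by ring.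
  have -> : N0 * (Lam ^+ n * Lam ^+ n * v t n) ^+ 2 =
    Lam ^+ n * Lam ^+ n * (N0 * Lam ^+ n ^+ 2 * v t n ^+ 2) by ring.
  apply: ler_wpM2r; first exact: mulr_ge0 (mulr_ge0 (ltW N0_gt0) (sqr_ge0 _)) (sqr_ge0 _).
  apply: (@le_trans _ _ (Lam ^+ n)).
    by apply: lerXn2r (ltW theta_lt); rewrite nnegrE ltW.
  by rewrite ler_peMl// ltW// exprn_gt0.
have [N HN] := exists_expr_ge Lam_gt1 ((theta + sigma^-1 / 2) * (N0 * C ^+ 2)).
pose g t := \sum_(n < N.+1) theta ^+ n * v t n.
apply: (@riccati_blowup T g (fun t => \sum_(n < N.+1) theta ^+ n * rhs k d (v t) n) A c (C1 + 1)) => //.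
- move=> t Tt'; apply: (@dw_sum _ _ (fun n s => theta ^+ n * v s n)
    (fun n => theta ^+ n * rhs k d (v t) n)) => n _.
  by apply: dw_scale; exact: dv.
- move=> t tT; have := weighted_rhs_ge d0 N0_gt0 Lam_gt1 theta_gt0 sigma_gt0
    sigma2 theta_sigma thetaq theta_lt (v t) N.
  rewrite /= -/c -/C1 -/(g t). apply: le_trans; rewrite opprD addrA lerD2l lerN2.
  have s0 : 0 <= sigma^-1 / 2 by rewrite divr_ge0// invr_ge0 ltW.
  have LN : 0 < Lam ^+ N by exact: exprn_gt0.
  have H1 := ler_wpM2l (ltW theta_gt0) (aC t N tT).
  have H2 := ler_wpM2l s0 (aC t N.+1 tT).
  have H3 : N0 * C ^+ 2 / Lam ^+ N.+1 <= N0 * C ^+ 2 / Lam ^+ N.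
    rewrite ler_wpM2l ?mulr_ge0 ?sqr_ge0 ?(ltW N0_gt0)//.
    by rewrite lef_pV2 ?posrE ?exprn_gt0// ler_weXn2l// ltW.
  have H4 := ler_wpM2l s0 H3.
  apply: le_trans (lerD H1 (le_trans H2 H4)) _.
  by rewrite -mulrDl mulrA ler_pdivrMr// mul1r.
- rewrite /g big_ord_recl/= vh hE expr0 mul1r big1 ?addr0// => i _.
  by rewrite vh hE mulr0.
Qed.
End Supercritical.
End BlowUp.

(** * Smooth solutions *)

Section SmoothSolutions.
Variables (R : realType) (N0 nu Lam alpha : R).
Hypotheses (N0_gt0 : 0 < N0) (nu_gt0 : 0 < nu) (Lam_gt1 : 1 < Lam).
Implicit Types (h : nat -> R) (u v : R -> nat -> R) (T : \bar R).

Local Notation k := (freq N0 Lam).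
Local Notation d := (viscosity N0 nu Lam alpha).

Let Lam_gt0 : 0 < Lam. Proof. exact: lt_trans Lam_gt1. Qed.

Lemma viscosityE : d = fun n => nu * N0 `^ (2 * alpha) * (Lam `^ (2 * alpha)) ^+ n.
Proof.
apply/funext => n; rewrite /viscosity /freq powRM ?exprn_ge0 ?ltW// mulrA.
by rewrite -powR_mulrn ?ltW// powRAC powR_mulrn ?powR_ge0.
Qed.

Lemma rapid_l2 h : nonneg_seq h -> rapid Lam h ->
  exists S, forall N, \sum_(i < N) h i ^+ 2 <= S.
Proof.
move=> h0 hr; have [C0 HC0] := hr 0%N; have [C1 HC1] := hr 1%N.
have z01 : 0 <= Lam^-1 < 1 by rewrite invr_ge0 invf_lt1// ltW.
exists (C1 * C0 * (1 - Lam^-1)^-1) => N.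
have C00 : 0 <= C0 by apply: le_trans (HC0 0%N); rewrite expr0 mul1r.
have C10 : 0 <= C1 by apply: le_trans (HC1 0%N); rewrite expr0 mul1r.
apply: le_trans (ler_wpM2l (mulr_ge0 C10 C00) (sum_geometric_le N z01)).
rewrite mulr_sumr; apply: ler_sum => i _; rewrite exprVn ler_pdivlMr ?exprn_gt0//.
rewrite expr2 mulrAC [h i * _]mulrC; apply: ler_pM => //.
- by rewrite mulr_ge0// exprn_ge0// ltW.
- by have := HC0 i; rewrite expr0 expr1n mul1r.
Qed.

Definition locally_rapid T u := forall p t, times T t ->
  exists C, forall r n, 0 <= r <= t -> (Lam ^+ p) ^+ n * u r n <= C.

Lemma nonneg_smooth_rapid h T v : nonneg_smooth_solution N0 Lam nu alpha h T v ->
  shell_solution k d h T v /\ locally_rapid T v.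
Proof.
move=> [T0 fv sv nv]; split; first exact: finite_energy_shell.
move=> p t Tt; have [C HC] := smooth_on_bound N0_gt0 Lam_gt1 p sv (times_segment (lexx 0) Tt).
by exists C => r n rt; exact: HC.
Qed.

Lemma rapid_nonneg_smooth h T u S : (0 < T)%E -> (forall N, \sum_(i < N) h i ^+ 2 <= S) ->
  shell_solution k d h T u -> locally_rapid T u ->
  nonneg_smooth_solution N0 Lam nu alpha h T u.
Proof.
move=> T0 hS hu ur; have [u0 _ _] := hu; split => //.
  exact: (shell_finite_energy N0_gt0 nu_gt0 Lam_gt1 T0 hS hu).
exact: (bound_smooth_on N0_gt0 Lam_gt1 u0 ur).
Qed.

Lemma locally_rapid_unique h T u v t S : (forall N, \sum_(i < N) h i ^+ 2 <= S) ->
  shell_solution k d h T u -> shell_solution k d h T v -> locally_rapid T u ->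
  times T t -> forall n, v t n = u t n.
Proof.
move=> hS hu hv ur Tt; have [C HC] := ur 1%N t Tt.
by apply: (solution_unique N0_gt0 nu_gt0 Lam_gt1 hS hu hv Tt) => r n rt; exact: HC.
Qed.

Lemma shell_Leray_Hopf h u S : (forall N, \sum_(i < N) h i ^+ 2 <= S) ->
  shell_solution k d h +oo u -> Leray_Hopf N0 Lam nu alpha h +oo u.
Proof.
move=> hS hu; split => //; first exact: (shell_finite_energy N0_gt0 nu_gt0 Lam_gt1 _ hS hu).
  move=> t t0 Tt; apply: (shell_energy_ineq N0_gt0 nu_gt0 Lam_gt1 hu) => //.
apply: aeW => t0 t00 _ t t0t _.
apply: (shell_energy_ineq N0_gt0 nu_gt0 Lam_gt1 hu) => //; first exact: ltW.
by apply/times_pinfty; apply: le_trans t0t; exact: ltW.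
Qed.

Lemma shell_solution_sub h T u : shell_solution k d h +oo u -> shell_solution k d h T u.
Proof.
have sub : times T `<=` times +oo by move=> t [t0 _]; exact/times_pinfty.
move=> [u0 du uh]; split=> // [t /sub|n t /[dup] /sub Tt _]; first exact: u0.
exact: dw_sub (du n t Tt).
Qed.

Lemma global_regularity h : 2 < Lam `^ (2 * alpha) -> Lam ^+ 2 <= (Lam `^ (2 * alpha)) ^+ 3 ->
  nonneg_seq h -> in_Hinf N0 Lam h ->
  exists u, [/\ Leray_Hopf N0 Lam nu alpha h +oo u, nonneg_on (times +oo) u,
    smooth_on N0 Lam (times +oo) u
  & forall v, Leray_Hopf N0 Lam nu alpha h +oo v -> nonneg_on (times +oo) v ->
    forall t n, 0 <= t -> v t n = u t n].
Proof.
move=> q2 q3 h0 /(in_Hinf_rapid N0_gt0 Lam_gt1) hr.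
have nuN : 0 < nu * N0 `^ (2 * alpha) by rewrite mulr_gt0// powR_gt0.
have [S hS] := rapid_l2 h0 hr.
have [u hu Hu] := exists_shell_solution (freq_ge0 N0_gt0 Lam_gt1)
  (viscosity_gt0 alpha N0_gt0 nu_gt0 Lam_gt1) h0.
have ur : locally_rapid +oo u.
  move=> p t _; have [C HC] := truncated_rapid N0_gt0 nuN Lam_gt1 q2 q3 h0 hr p.
  exists C => r n /andP[r0 _]; rewrite mulrC -ler_pdivlMr ?exprn_gt0//.
  apply: Hu => // K v; rewrite viscosityE => hv.
  by rewrite ler_pdivlMr ?exprn_gt0// mulrC; exact: HC hv r0.
exists u; have [u0 _ _] := hu; split => //.
- exact: shell_Leray_Hopf hS hu.
- exact: (bound_smooth_on N0_gt0 Lam_gt1 u0 ur).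
- move=> v [T0 fv _ _] v0 t n t0.
  apply: (locally_rapid_unique hS hu _ ur); last exact/times_pinfty.
  exact: finite_energy_shell.
Qed.

(** Every smooth solution coincides with the global solution [u] on its interval, so [u] inherits
    rapid decay at each time before [Tmax]. The interval up to [T0] makes [Tmax] positive. *)
Lemma maximal_solution h u S (T0 : R) : (forall N, \sum_(i < N) h i ^+ 2 <= S) ->
  shell_solution k d h +oo u -> 0 < T0 -> locally_rapid T0%:E u ->
  maximal_smooth_solution N0 Lam nu alpha h u.
Proof.
move=> hS hu T00 ur.
have T0m : [set T | exists u, nonneg_smooth_solution N0 Lam nu alpha h T u] T0%:E.
  by exists u; apply: rapid_nonneg_smooth hS _ ur => //; exact: shell_solution_sub.
apply: (rapid_nonneg_smooth _ hS) => //.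
- by apply: lt_le_trans (ereal_sup_ubound T0m); rewrite lte_fin.
- exact: shell_solution_sub.
move=> p t [t0 tT].
have [T [v Hv] tT'] : exists2 T, (exists v, nonneg_smooth_solution N0 Lam nu alpha h T v) & (t%:E < T)%E.
  apply: contrapT => H; move: tT; rewrite ltNge => /negP; apply.
  apply: ge_ereal_sup => T [v Hv]; rewrite leNgt; apply/negP => tT.
  by apply: H; exists T => //; exists v.
have [hv vr] := nonneg_smooth_rapid Hv.
have [C HC] := vr p t (conj t0 tT').
exists C => r n rt; have /andP[r0 r_t] := rt.
have Tr : times T r by split=> //; apply: le_lt_trans tT'; rewrite lee_fin.
by rewrite (locally_rapid_unique hS hv (shell_solution_sub T hu) vr Tr) HC.
Qed.

Definition single_shell A n : R := if n is 0 then A else 0.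

Lemma single_shell_sum (A : R) (c : nat -> R) N : 0 <= c 0%N ->
  \sum_(i < N) c i * single_shell A i ^+ 2 <= c 0%N * A ^+ 2.
Proof.
move=> c0; case: N => [|N]; first by rewrite big_ord0 mulr_ge0// sqr_ge0.
by rewrite big_ord_recl big1 ?addr0// => i _; rewrite /= expr0n mulr0.
Qed.

Lemma single_shell_Hinf A : in_Hinf N0 Lam (single_shell A).
Proof.
move=> s _; apply: le_lt_trans (ltry (k 0 `^ (2 * s) * A ^+ 2)).
apply: nneseries_le => [n|N]; first by rewrite mulr_ge0 ?powR_ge0// sqr_ge0.
under eq_bigr do rewrite real_normK ?num_real//.
by apply: (single_shell_sum A (c := fun n => k n `^ (2 * s))); exact: powR_ge0.
Qed.

(* The Riccati time of k_n u_n, for which N0 A bounds the datum. *)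
Lemma single_shell_local A u : 0 < A -> shell_solution k d (single_shell A) +oo u ->
  locally_rapid ((Lam * (N0 * A))^-1)%:E u.
Proof.
move=> A0 hu; have [u0 du uh] := hu; set B := N0 * A; set T := _^-1.
have B0 : 0 < B by rewrite mulr_gt0.
have un t n : 0 <= t -> 0 <= u t n by move=> t0; apply: u0; apply/times_pinfty.
have k0 n : 0 < k n by exact: freq_gt0.
have d0 n : 0 <= d n by exact: viscosity_ge0.
have rhs_le t n : 0 <= t -> rhs k d (u t) n <= inflow k (u t) n.
  move=> t0; have := mulr_ge0 (d0 n) (un t n t0).
  have : 0 <= k n * u t n * u t n.+1.
    by apply: mulr_ge0 (un _ _ t0); apply: mulr_ge0 (ltW (k0 n)) (un _ _ t0).
  rewrite /rhs; lra.
have u_A t : 0 <= t -> u t 0%N <= A.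
  move=> t0; have := @dw_times_le _ +oo (fun s => u s 0%N) (fun s => rhs k d (u s) 0)
    0 0 t (lexx 0) t0 (proj2 (times_pinfty t) t0).
  rewrite mul0r addr0 uh; apply => [r|r /andP[r0 _]]; first exact: du.
  exact: rhs_le.
have kuB n t : 0 <= t <= T -> k n * u t n <= B.
  elim: n t => [|n IHn] t /andP[t0 tT].
    rewrite /freq expr0 mulr1 /B ler_pM2l//; exact: u_A.
  apply: (@le_trans _ _ (0 + Lam * B ^+ 2 * (t - 0))); last first.
    rewrite add0r subr0 expr2 mulrA mulrAC -[X in _ <= X]mul1r ler_pM2r// mulrC.
    by rewrite -ler_pdivlMr ?mulr_gt0// div1r.
  have := @dw_times_le _ +oo (fun s => k n.+1 * u s n.+1)
    (fun s => k n.+1 * rhs k d (u s) n.+1) (Lam * B ^+ 2) 0 t (lexx 0) t0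
    (proj2 (times_pinfty t) t0).
  rewrite uh mulr0; apply => [r Tr|r /andP[r0 rt]]; first by apply: dw_scale; exact: du.
  apply: le_trans (ler_wpM2l (ltW (k0 n.+1)) (rhs_le r n.+1 r0)) _ => /=.
  have -> : k n.+1 * (k n * u r n ^+ 2) = Lam * (k n * u r n) ^+ 2.
    by rewrite /freq exprS; ring.
  rewrite ler_pM2l// lerXn2r ?nnegrE ?(ltW B0)//.
    by apply: mulr_ge0 (ltW (k0 n)) (un _ _ r0).
  by apply: IHn; rewrite r0 (le_trans rt).
move=> p t [t0]; rewrite lte_fin => /ltW tT.
(* Once k_n u_n <= B, the inflow into Lam^(p (n+1)) u_(n+1) is at most c Lam^(p n) u_n, a linear
   recursion for which A exp(c r) is a supersolution at every shell. *)
pose c := Lam ^+ p * B.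
have Lp : 0 < Lam ^+ p by exact: exprn_gt0.
have c0 : 0 <= c by rewrite mulr_ge0// ltW.
have vA n r : 0 <= r <= T -> (Lam ^+ p) ^+ n * u r n <= A * expR (c * r).
  elim: n r => [|n IHn] r /andP[r0 rT].
    rewrite expr0 mul1r; apply: le_trans (u_A r r0) _.
    by rewrite ler_peMr ?(ltW A0)// -expR0 ler_expR mulr_ge0.
  have := @dw_times_le _ +oo (fun s => (Lam ^+ p) ^+ n.+1 * u s n.+1 - A * expR (c * s))
    (fun s => (Lam ^+ p) ^+ n.+1 * rhs k d (u s) n.+1 - A * (c * expR (c * s))) 0 0 r (lexx 0) r0
    (proj2 (times_pinfty r) r0).
  rewrite uh !mulr0 expR0 mulr1 mul0r addr0 sub0r => H; rewrite -subr_le0.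
  apply: (le_trans (H _ _)); last by rewrite oppr_le0 ltW.
    move=> s Ts; apply: dw_add; first by apply: dw_scale; exact: du.
    by apply: dw_opp; apply: dw_scale; exact: dw_expR.
  move=> s /andP[s0 sr]; rewrite subr_le0.
  have sT : 0 <= s <= T by rewrite s0 (le_trans sr).
  have Lpn : 0 <= (Lam ^+ p) ^+ n.+1 by rewrite exprn_ge0// ltW.
  apply: le_trans (ler_wpM2l Lpn (rhs_le s n.+1 s0)) _ => /=.
  have -> : (Lam ^+ p) ^+ n.+1 * (k n * u s n ^+ 2) =
    Lam ^+ p * (k n * u s n) * ((Lam ^+ p) ^+ n * u s n).
    by rewrite [(Lam ^+ p) ^+ n.+1]exprS; ring.
  rewrite [X in _ <= X]mulrCA; apply: ler_pM.
  - by apply: mulr_ge0 (ltW Lp) _; apply: mulr_ge0 (ltW (k0 n)) (un _ _ s0).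
  - by apply: mulr_ge0 (un _ _ s0); rewrite exprn_ge0// ltW.
  - by rewrite ler_pM2l//; exact: kuB.
  - exact: IHn.
exists (A * expR (c * T)) => r n /andP[r0 rt]; have rT := le_trans rt tT.
apply: le_trans (vA n r _) _; first by rewrite r0.
by rewrite ler_pM2l// ler_expR ler_wpM2l.
Qed.

Lemma finite_time_blowup : 0 < alpha < 1 / 3 ->
  exists h u, [/\ nonneg_seq h, in_Hinf N0 Lam h,
    maximal_smooth_solution N0 Lam nu alpha h u & (Tmax N0 Lam nu alpha h < +oo)%E].
Proof.
move=> /andP[a0 a13].
have pw x y : x < y -> Lam `^ x < Lam `^ y by move=> xy; rewrite /powR !gt_eqF// ltr_expR ltr_pM2r ?ln_gt0.
have L1 : Lam `^ 1 = Lam by rewrite powRr1// ltW.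
have LD x y : Lam `^ x * Lam `^ y = Lam `^ (x + y).
  by rewrite powRD//; apply/implyP => _; rewrite gt_eqF.
(* With these exponents theta sigma = Lam^(1 - 3 alpha) and theta q^2 / Lam = Lam^(2 alpha - 2/3);
   both conditions hold exactly for alpha < 1/3. *)
have [] := @rapid_blowup R N0 Lam (nu * N0 `^ (2 * alpha)) (Lam `^ (2 * alpha))
  (Lam `^ (3^-1 - 2 * alpha)) (Lam `^ (2 * 3^-1 - alpha)) N0_gt0 Lam_gt1.
- exact: powR_gt0.
- exact: powR_gt0.
- by rewrite -{2}L1 LD expr2 LD; congr (_ `^ _); field.
- by rewrite LD -[X in X < _](powRr0 Lam); apply: pw; lra.
- by rewrite expr2 !LD -[X in _ < X]L1; apply: pw; lra.
- by rewrite -[X in _ < X]L1; apply: pw; lra.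
rewrite -viscosityE => A [T1 [A0 T10 HB]].
have h0 : nonneg_seq (single_shell A) by case=> //= ; exact: ltW.
have hS N : \sum_(i < N) single_shell A i ^+ 2 <= 1 * A ^+ 2.
  by have := @single_shell_sum A (fun=> 1) N ler01; under eq_bigr do rewrite mul1r.
have [u hu _] := exists_shell_solution (freq_ge0 N0_gt0 Lam_gt1)
  (viscosity_gt0 alpha N0_gt0 nu_gt0 Lam_gt1) h0.
exists (single_shell A), u; split => //; first exact: single_shell_Hinf.
  by apply: maximal_solution hS hu _ (single_shell_local A0 hu); rewrite invr_gt0 !mulr_gt0.
apply: le_lt_trans (ltry T1); apply: ge_ereal_sup => T [v Hv]; rewrite leNgt; apply/negP => T1T.
have [hv vr] := nonneg_smooth_rapid Hv.
have TT1 : times T T1 by split=> //; exact: ltW.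
have [C HC] := vr 2%N T1 TT1.
by apply: (HB T _ v _ hv TT1) => //; exists C.
Qed.
End SmoothSolutions.

Theorem corollary6p5 (R : realType) (N0 nu Lam : R)
    (hN0 : 0 < N0) (hnu : 0 < nu) (hLam : 2 `^ (3 / 2) < Lam) :
  (forall alpha : R, 1 / 3 <= alpha ->
     forall h : nat -> R, nonneg_seq h -> in_Hinf N0 Lam h ->
     exists u : R -> nat -> R,
       [/\ Leray_Hopf N0 Lam nu alpha h +oo%E u,
           nonneg_on (times +oo%E) u,
           smooth_on N0 Lam (times +oo%E) u
         & forall v : R -> nat -> R,
             Leray_Hopf N0 Lam nu alpha h +oo%E v ->
             nonneg_on (times +oo%E) v ->
             forall (t : R) (n : nat), 0 <= t -> v t n = u t n]) /\
  (forall alpha : R, 0 < alpha -> alpha < 1 / 3 ->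
     exists (h : nat -> R) (u : R -> nat -> R),
       [/\ nonneg_seq h,
           in_Hinf N0 Lam h,
           maximal_smooth_solution N0 Lam nu alpha h u
         & (Tmax N0 Lam nu alpha h < +oo)%E]).
Proof.
have Lam_gt1 : 1 < Lam.
  apply: le_lt_trans hLam; rewrite -[X in X <= _](powRr0 2).
  by apply: ler_powR; [rewrite ler1n | rewrite divr_ge0].
split=> [alpha a13 h|alpha a0 a13]; last first.
  by apply: finite_time_blowup => //; rewrite a0.
have Lam0 : 0 <= Lam by rewrite ltW// (lt_trans ltr01).
apply: global_regularity => //.
(* Raising 2^(3/2) < Lam to the power 2/3 gives 2 < Lam^(2/3) <= q. *)
- apply: (@lt_le_trans _ _ (Lam `^ (2 / 3))); last by apply: ler_powR; [exact: ltW | lra].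
  have E : (2 `^ (3 / 2)) `^ (2 / 3) = 2 :> R.
    rewrite -powRrM (_ : 3 / 2 * (2 / 3) = 1 :> R); last by field.
    by rewrite powRr1.
  by rewrite -{1}E; apply: gt0_ltr_powR; rewrite ?nnegrE ?powR_ge0// divr_gt0.
- rewrite -!powR_mulrn ?powR_ge0// -powRrM.
  by apply: ler_powR; [exact: ltW | lra].
Qed.
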